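(* Fix constants $m_0>0$, $\phi_0(1)=-\phi_0(-1)>0$ and $0<\gamma_{max}<\infty$ (independent of $\varepsilon$), and set $M=\sqrt{\frac{m_0}{2e^{\phi_0(1)}}}$ and $K_0=\sup_{0<|y|\le \phi_0(1)}\frac{|e^y-1|}{|y|}$. There exists $\tilde\varepsilon'>0$, depending only on $m_0$ and $\phi_0(1)$, such that the following holds for every $0<\varepsilon<\tilde\varepsilon'$. Suppose that $$0<\gamma_\varepsilon\le\gamma_{max},\qquad \frac{\gamma_\varepsilon}{\sqrt\varepsilon}>\frac{\left((1+2\gamma_{max})^2+3\right)K_0\phi_0(1)}{4M},$$ and let $(\tilde\delta,\tilde\eta,\tilde\phi)$ be a solution of the nonlinear perturbed problem (NP) of the context such that $\int_{-1}^1\tilde\delta(x,0)\,dx=\int_{-1}^1\tilde\eta(x,0)\,dx=0$. Put $\tilde n=\frac12(\tilde\delta+\tilde\eta)$, $\tilde p=\frac12(\tilde\eta-\tilde\delta)$, and suppose that $n_0(x)=n^0(x)+\tilde n(x,0)$ and $p_0(x)=p^0(x)+\tilde p(x,0)$ satisfy $n_0,p_0\in L^2(-1,1)$ and $n_0(x)\ge0$, $p_0(x)\ge0$ for $x\in(-1,1)$. Then, with $\bar D,\bar H,d,h$ as defined in the context, $$\frac{d}{dt}\left[\frac12\int_{-1}^1(\bar D^2+\bar H^2)\,dx+d^2+h^2\right]\le-\int_{-1}^1\left(\bar D_x^2+\left(\frac12-\frac{d^2}{m_0\varepsilon}\right)\bar H_x^2\right)dx-\frac{1}{4\varepsilon}m_{0,\varepsilon}'\int_{-1}^1\bar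 D^2\,dx$$ for all $t>0$, where $m_{0,\varepsilon}'=m_0\left[1-2K_0\phi_0(1)\frac{\sqrt\varepsilon}{M}\right]>\frac{m_0}{2}$. Moreover, if the initial data satisfy $$I_0:=\left[\frac12\int_{-1}^1(\bar D^2+\bar H^2)\,dx+d^2+h^2\right]_{t=0}<\frac{\theta m_0\varepsilon}{2}$$ for some $0<\theta<1$, then $\frac12-\frac{d(t)^2}{m_0\varepsilon}>\frac12(1-\theta)>0$ for all $t\ge0$.
   Context: Boundary layer steady state. For $\varepsilon>0$, $\gamma_\varepsilon>0$ (a constant which may depend on $\varepsilon$), $m_0>0$ and constants $\phi_0(1)=-\phi_0(-1)>0$, let $\psi$ be the solution of $$\varepsilon\psi_{xx}=\frac{m_0e^{\psi}}{\int_{-1}^1e^{\psi}dx}-\frac{m_0e^{-\psi}}{\int_{-1}^1e^{-\psi}dx}\ \text{ in }(-1,1),\qquad \psi(\pm1)\pm\gamma_\varepsilon\psi_x(\pm1)=\phi_0(\pm1).$$ Put $n^0=\frac{m_0e^{\psi}}{\int_{-1}^1e^{\psi}dx}$, $p^0=\frac{m_0e^{-\psi}}{\int_{-1}^1e^{-\psi}dx}$, $\delta^0=n^0-p^0$, $\eta^0=n^0+p^0$. Nonlinear perturbed problem (NP), for unknowns $(\tilde\delta,\tilde\eta,\tilde\phi)$ depending on $x\in(-1,1)$, $t>0$: $$\tilde\delta_t=\tilde\delta_{xx}-(\eta^0\tilde\phi_x)_x-(\tilde\eta\psi_x)_x-(\tilde\eta\tilde\phi_x)_x,\quad \tilde\eta_t=\tilde\eta_{xx}-(\delta^0\tilde\phi_x)_x-(\tilde\delta\psi_x)_x-(\tilde\delta\tilde\phi_x)_x,\quad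 \varepsilon\tilde\phi_{xx}=\tilde\delta,$$ with boundary conditions $$\tilde\delta_x-\eta^0\tilde\phi_x-\tilde\eta\psi_x-\tilde\eta\tilde\phi_x=\tilde\eta_x-\delta^0\tilde\phi_x-\tilde\delta\psi_x-\tilde\delta\tilde\phi_x=0,\qquad \tilde\phi\pm\gamma_\varepsilon\tilde\phi_x=0\qquad\text{at }x=\pm1.$$ With $\tilde n=\frac12(\tilde\delta+\tilde\eta)$, $\tilde p=\frac12(\tilde\eta-\tilde\delta)$, this is equivalent to $(n,p,\phi)=(n^0+\tilde n,p^0+\tilde p,\psi+\tilde\phi)$ solving the Poisson–Nernst–Planck system $n_t=\partial_x(n_x-n\phi_x)$, $p_t=\partial_x(p_x+p\phi_x)$, $\varepsilon\phi_{xx}=n-p$ with $n_x-n\phi_x=p_x+p\phi_x=0$ and $\phi\pm\gamma_\varepsilon\phi_x=\phi_0(\pm1)$ at $x=\pm1$. Solutions are understood to be classical on $[-1,1]$ for $t>0$, with initial data attained continuously in $L^2(-1,1)$. Notation: $D(x,t)=\int_{-1}^x\tilde\delta(s,t)\,ds$, $H(x,t)=\int_{-1}^x\tilde\eta(s,t)\,ds$, $d(t)=\frac12\int_{-1}^1D(x,t)\,dx$, $h(t)=\frac12\int_{-1}^1H(x,t)\,dx$, $\bar D=D-d$, $\bar H=H-h$. *)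

(* Defs.v *)
From HB Require Import structures.
From mathcomp Require Import all_boot all_order all_algebra.
From mathcomp Require Import all_classical all_reals all_analysis.

Set Implicit Arguments.
Unset Strict Implicit.
Unset Printing Implicit Defensive.

Import Order.TTheory GRing.Theory Num.Theory.
Import numFieldNormedType.Exports.

Local Open Scope classical_set_scope.
Local Open Scope ring_scope.

(* Derivative on the closed interval [-1, 1]: the usual two-sided one at an   *)
(* interior point, the one-sided one at an endpoint. Values of f outside      *)
(* [-1, 1] are never used.                                                    *)
Definition diffquotI (R : realType) (f : R -> R) (x : R) : set_system R :=
  (f y - f x) / (y - x) @[y --> within `[-1, 1] x^'].

Definition derivableI (R : realType) (f : R -> R) (x : R) : Prop :=
  cvg (diffquotI f x).

Definition dI (R : realType) (f : R -> R) (x : R) : R := lim (diffquotI f x).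

Definition C1I (R : realType) (f : R -> R) : Prop :=
  [/\ {within `[-1, 1], continuous f},
      {in `[-1, 1], forall x, derivableI f x}
    & {within `[-1, 1], continuous (dI f)}].

Definition C2I (R : realType) (f : R -> R) : Prop := C1I f /\ C1I (dI f).

(* A space-time function is u : R -> R -> R, evaluated as u x t. *)
Definition dx (R : realType) (u : R -> R -> R) : R -> R -> R :=
  fun x t => dI (fun y => u y t) x.

Definition dt (R : realType) (u : R -> R -> R) : R -> R -> R :=
  fun x t => derive1 (u x) t.

(* Joint continuity on [-1, 1] x (0, +oo). *)
Definition contQ (R : realType) (u : R -> R -> R) : Prop :=
  {within `[-1, 1] `*` `]0, +oo[,
     continuous (fun z : R * R => u z.1 z.2)}.

Definition C1x (R : realType) (u : R -> R -> R) : Prop :=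
  [/\ contQ u,
      forall x t : R, -1 <= x <= 1 -> 0 < t -> derivableI (fun y => u y t) x
    & contQ (dx u)].

Definition C2x (R : realType) (u : R -> R -> R) : Prop :=
  C1x u /\ C1x (dx u).

Definition C1t (R : realType) (u : R -> R -> R) : Prop :=
  (forall x t : R, -1 <= x <= 1 -> 0 < t -> derivable (u x) t 1)
  /\ contQ (dt u).

Definition cations0 (R : realType) (m0 : R) (psi : R -> R) (x : R) : R :=
  m0 * expR (psi x) / \int[lebesgue_measure]_(y in `[-1, 1]) expR (psi y).

Definition anions0 (R : realType) (m0 : R) (psi : R -> R) (x : R) : R :=
  m0 * expR (- psi x) / \int[lebesgue_measure]_(y in `[-1, 1]) expR (- psi y).

Definition delta0 (R : realType) (m0 : R) (psi : R -> R) (x : R) : R :=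
  cations0 m0 psi x - anions0 m0 psi x.

Definition eta0 (R : realType) (m0 : R) (psi : R -> R) (x : R) : R :=
  cations0 m0 psi x + anions0 m0 psi x.

(* phi1 is the boundary datum phi_0(1); the datum at -1 is - phi1. *)
Record steady_state (R : realType) (m0 phi1 eps gam : R) (psi : R -> R)
    : Prop := SteadyState {
  ss_C2 : C2I psi;
  ss_poisson : forall x : R, -1 < x < 1 ->
    eps * dI (dI psi) x = cations0 m0 psi x - anions0 m0 psi x;
  ss_right : psi 1 + gam * dI psi 1 = phi1;
  ss_left : psi (-1) - gam * dI psi (-1) = - phi1
}.

Definition flux_delta (R : realType) (m0 : R) (psi : R -> R)
    (delta eta phi : R -> R -> R) (x t : R) : R :=
  dx delta x t - eta0 m0 psi x * dx phi x t - eta x t * dI psi x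
  - eta x t * dx phi x t.

Definition flux_eta (R : realType) (m0 : R) (psi : R -> R)
    (delta eta phi : R -> R -> R) (x t : R) : R :=
  dx eta x t - delta0 m0 psi x * dx phi x t - delta x t * dI psi x
  - delta x t * dx phi x t.

Definition L2norm (R : realType) (f : R -> R) : \bar R :=
  ('N[@lebesgue_measure R]_(2%:E) [EFin \o (f \_ `]-1, 1[)%R])%E.

Definition in_L2 (R : realType) (f : R -> R) : Prop :=
  (f \_ `]-1, 1[) \in Lfun (@lebesgue_measure R) 2%:E.

(* The values of delta and eta at t = 0 are the initial data; phi is only     *)
(* constrained for t > 0.                                                     *)
Record NP_solution (R : realType) (m0 eps gam : R) (psi : R -> R)
    (delta eta phi : R -> R -> R) : Prop := NPSolution {
  np_delta_x : C2x delta;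
  np_delta_t : C1t delta;
  np_eta_x : C2x eta;
  np_eta_t : C1t eta;
  np_phi_x : C2x phi;
  np_delta_eq : forall x t : R, -1 < x < 1 -> 0 < t ->
    dt delta x t = dx (dx delta) x t
      - dx (fun y s => eta0 m0 psi y * dx phi y s) x t
      - dx (fun y s => eta y s * dI psi y) x t
      - dx (fun y s => eta y s * dx phi y s) x t;
  np_eta_eq : forall x t : R, -1 < x < 1 -> 0 < t ->
    dt eta x t = dx (dx eta) x t
      - dx (fun y s => delta0 m0 psi y * dx phi y s) x t
      - dx (fun y s => delta y s * dI psi y) x t
      - dx (fun y s => delta y s * dx phi y s) x t;
  np_poisson : forall x t : R, -1 < x < 1 -> 0 < t ->
    eps * dx (dx phi) x t = delta x t;
  np_flux_delta : forall t : R, 0 < t ->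
    flux_delta m0 psi delta eta phi (-1) t = 0 /\
    flux_delta m0 psi delta eta phi 1 t = 0;
  np_flux_eta : forall t : R, 0 < t ->
    flux_eta m0 psi delta eta phi (-1) t = 0 /\
    flux_eta m0 psi delta eta phi 1 t = 0;
  np_robin_right : forall t : R, 0 < t -> phi 1 t + gam * dx phi 1 t = 0;
  np_robin_left : forall t : R, 0 < t -> phi (-1) t - gam * dx phi (-1) t = 0;
  np_delta_init :
    L2norm (fun x => delta x t - delta x 0) @[t --> 0^'+] --> 0%E;
  np_eta_init :
    L2norm (fun x => eta x t - eta x 0) @[t --> 0^'+] --> 0%E
}.

Definition primitive (R : realType) (u : R -> R -> R) (x t : R) : R :=
  \int[lebesgue_measure]_(s in `[-1, x]) u s t.

Definition mean_primitive (R : realType) (u : R -> R -> R) (t : R) : R :=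
  2^-1 * \int[lebesgue_measure]_(x in `[-1, 1]) primitive u x t.

(* With u = delta (resp. eta), primitive u, mean_primitive u, primitive_bar u *)
(* are D, d, \bar D (resp. H, h, \bar H).                                     *)
Definition primitive_bar (R : realType) (u : R -> R -> R) (x t : R) : R :=
  primitive u x t - mean_primitive u t.

Definition energy (R : realType) (delta eta : R -> R -> R) (t : R) : R :=
  2^-1 * (\int[lebesgue_measure]_(x in `[-1, 1])
            (primitive_bar delta x t ^+ 2 + primitive_bar eta x t ^+ 2))
  + mean_primitive delta t ^+ 2 + mean_primitive eta t ^+ 2.

Definition Mconst (R : realType) (m0 phi1 : R) : R :=
  Num.sqrt (m0 / (2 * expR phi1)).

Definition K0const (R : realType) (phi1 : R) : R :=
  sup [set `|expR y - 1| / `|y| | y in [set y : R | 0 < `|y| <= phi1]].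

Definition m0eps (R : realType) (m0 phi1 eps : R) : R :=
  m0 * (1 - 2 * K0const phi1 * phi1 * (Num.sqrt eps / Mconst m0 phi1)).

(* Main.v *)
Require Import Defs.
From HB Require Import structures.
From mathcomp Require Import all_boot all_order all_algebra.
From mathcomp Require Import all_classical all_reals all_analysis measurable_realfun.
From mathcomp Require Import ring lra.

Set Implicit Arguments.
Unset Strict Implicit.
Unset Printing Implicit Defensive.

Import Order.TTheory GRing.Theory Num.Theory.
Import numFieldNormedType.Exports.

Local Open Scope classical_set_scope.
Local Open Scope ring_scope.

(** Let [D] and [H] be the primitives of [delta] and [eta] that vanish at the left
    wall. The fluxes vanish at the walls, so both masses are conserved; they are
    zero initially, hence [D] and [H] vanish at both walls. Splitting off means is
    orthogonal, so the energy of the statement is half the squared [L^2] norm of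
    the pair [(D, H)], whose time derivatives are simply the two fluxes.

    Poisson's equation and the Robin conditions give [eps * phi_x = D - d / (1 +
    gam)] ([perturbed_field]). Differentiating the energy and inserting this, the
    terms in which [D] and [H] meet the steady charge cancel, and only
    [- delta^2 - eta^2 - eta0 phi_x D - D^2 eta / (2 eps)] and one term containing
    the steady field are left ([dissipation_identity]). The cubic term is not small,
    but [eta0 + eta] is the total concentration [n + p]. As long as this is
    nonnegative, half of the damping [eta0 D^2] controls it. Nonnegativity is
    inherited from the initial data: the negative part of a solution of a
    drift-diffusion equation with no flux through the walls obeys a Gronwall
    inequality starting from zero ([drift_diffusion_ge0]). Since the data are only
    square integrable, the negative part is measured by a twice differentiable
    function of quadratic growth, and the drift is bounded up to time zero because
    the field is a primitive of the charge.

    The remaining error terms carry the factor [d^2] or are linear of mean zero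
    ([dissipation_pointwise]). Two quantities of the steady boundary layer occur
    there: the deficit of [eta0] below its mean [m0], and [eps] times the integral
    of the squared steady field. Both are bounded by multiples of [sqrt (m0 eps)
    (exp phi1 - 1)] ([eta0_lower], [field_energy]), through the first integral
    [psi'^2 = C + 4 k sinh^2 (psi / 2)] of the steady equation: it makes [psi]
    monotone, and turns integrals over the layer into integrals in [psi]. The Robin
    conditions dissipate [d^2] at a rate proportional to [m0 * gam], which beats the
    layer terms under the lower bound on [gam / sqrt eps] ([layer_budget]).

    For the last claim, [d^2] is at most the energy. While the energy is below
    [theta m0 eps / 2], the dissipation is nonnegative and the energy does not
    increase, so it can never reach that value ([stays_below]). *)

(** * Calculus on a compact interval *)

Lemma ltN11 (R : numDomainType) : -1 < 1 :> R.
Proof. by rewrite (@lt_trans _ _ 0)// oppr_lt0. Qed.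

Lemma le_of_sqr (R : realDomainType) (x y : R) :
  0 <= y -> x ^+ 2 <= y ^+ 2 -> x <= y.
Proof. by move=> y0 xy; rewrite leNgt; apply/negP => yx; nra. Qed.

Section within_algebra.
Context {R : realType} {T : topologicalType}.
Implicit Types (A : set T) (f g : T -> R).

Lemma within_cst A (c : R) : {within A, continuous (fun _ : T => c)}.
Proof. by apply: continuous_subspaceT => x; exact: cvg_cst. Qed.

Lemma within_add A f g : {within A, continuous f} -> {within A, continuous g} ->
  {within A, continuous (fun x => f x + g x)}.
Proof. by move=> cf cg x; apply: cvgD; [exact: cf|exact: cg]. Qed.

Lemma within_opp A f : {within A, continuous f} ->
  {within A, continuous (fun x => - f x)}.
Proof. by move=> cf x; apply: cvgN; exact: cf. Qed.

Lemma within_sub A f g : {within A, continuous f} -> {within A, continuous g} ->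
  {within A, continuous (fun x => f x - g x)}.
Proof. by move=> cf cg x; apply: cvgB; [exact: cf|exact: cg]. Qed.

Lemma within_mul A f g : {within A, continuous f} -> {within A, continuous g} ->
  {within A, continuous (fun x => f x * g x)}.
Proof. by move=> cf cg x; apply: cvgM; [exact: cf|exact: cg]. Qed.

Lemma within_exp A f n : {within A, continuous f} ->
  {within A, continuous (fun x => f x ^+ n)}.
Proof.
move=> cf; elim: n => [|n ih]; first exact: within_cst.
by under eq_fun do rewrite exprS; exact: within_mul.
Qed.

Lemma within_comp A f (k : R -> R) : continuous k -> {within A, continuous f} ->
  {within A, continuous (fun x => k (f x))}.
Proof.
by move=> ck; apply: (@within_continuous_comp _ _ _ A f k) => z _; exact: ck.
Qed.

Lemma within_norm A f : {within A, continuous f} ->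
  {within A, continuous (fun x => `|f x|)}.
Proof. by apply: within_comp; exact: norm_continuous. Qed.

End within_algebra.
Arguments within_cst {R T} A c.
Arguments within_exp {R T A f} n.

(** The carrier of the bound variable in the integral notation is a measurable
    structure; taking the integrand as an argument of type [R -> R] keeps
    integrands comparable by rewriting. *)
Definition itg (R : realType) (a b : R) (f : R -> R) : R :=
  \int[lebesgue_measure]_(x in `[a, b]) f x.

Section compact_interval.
Context {R : realType}.
Notation mu := (@lebesgue_measure R).
Implicit Types (a b x : R) (f g F : R -> R).

Lemma integrable_within a b f : {within `[a, b], continuous f} ->
  mu.-integrable `[a, b] (EFin \o f).
Proof. by move=> cf; apply: continuous_compact_integrable => //; exact: segment_compact. Qed.

Lemma int_add a b f g :
  {within `[a, b], continuous f} -> {within `[a, b], continuous g} ->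
  itg a b (fun x => f x + g x) =
  itg a b f + itg a b g.
Proof. by move=> cf cg; rewrite /itg RintegralD//; exact: integrable_within. Qed.

Lemma int_sub a b f g :
  {within `[a, b], continuous f} -> {within `[a, b], continuous g} ->
  itg a b (fun x => f x - g x) =
  itg a b f - itg a b g.
Proof. by move=> cf cg; rewrite /itg RintegralB//; exact: integrable_within. Qed.

Lemma int_scale a b f c : {within `[a, b], continuous f} ->
  itg a b (fun x => c * f x) = c * itg a b f.
Proof. by move=> cf; rewrite /itg RintegralZl//; exact: integrable_within. Qed.

Lemma int_cst a b c : a <= b -> itg a b (fun x => c) = c * (b - a).
Proof.
move=> ab; rewrite /itg Rintegral_cst//= lebesgue_measure_itv/= lte_fin.
by case: ltgtP ab => //= -> _; rewrite subrr.
Qed.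

Lemma int_le_integrable a b f g :
  mu.-integrable `[a, b] (EFin \o f) -> mu.-integrable `[a, b] (EFin \o g) ->
  (forall x, a < x < b -> f x <= g x) -> itg a b f <= itg a b g.
Proof.
move=> If Ig fg.
have IO h : mu.-integrable `[a, b] (EFin \o h) -> mu.-integrable `]a, b[ (EFin \o h).
  by move=> Ih; apply: integrableS Ih => //; exact: subset_itv_oo_cc.
have oo h : mu.-integrable `[a, b] (EFin \o h) ->
    itg a b h = \int[mu]_(x in `]a, b[) h x.
  move=> Ih; have /integrableP[mh _] := IO h Ih.
  by rewrite /itg /Rintegral integral_itv_bndoo.
by rewrite !oo//; apply: (le_Rintegral _ (IO f If) (IO g Ig)) => //.
Qed.

Lemma int_le a b f g :
  {within `[a, b], continuous f} -> {within `[a, b], continuous g} ->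
  (forall x, a < x < b -> f x <= g x) ->
  itg a b f <= itg a b g.
Proof. by move=> cf cg; apply: int_le_integrable; exact: integrable_within. Qed.

Lemma int_norm_le a b f C : a <= b -> {within `[a, b], continuous f} ->
  (forall x, a < x < b -> `|f x| <= C) -> `|itg a b f| <= C * (b - a).
Proof.
move=> ab cf fC; rewrite ler_norml -mulNr -!int_cst//.
apply/andP; split.
  by apply: (int_le (within_cst _ _) cf) => x /fC; rewrite ler_norml => /andP[].
by apply: (int_le cf (within_cst _ _)) => x /fC; rewrite ler_norml => /andP[].
Qed.

Lemma int_ge0 a b f : (forall x, a <= x <= b -> 0 <= f x) -> 0 <= itg a b f.
Proof. by move=> f0; apply: Rintegral_ge0 => x /=; rewrite in_itv; exact: f0. Qed.

Lemma int_eq a b f g : (forall x, a <= x <= b -> f x = g x) ->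
  itg a b f = itg a b g.
Proof.
by move=> fg; apply: eq_Rintegral => x; rewrite inE/= in_itv/=; exact: fg.
Qed.

(** Values at the two endpoints do not matter, so an identity known only where
    two-sided derivatives exist still determines the integral. *)
Lemma int_eq_oo a b f g : {within `[a, b], continuous g} ->
  (forall x, a < x < b -> f x = g x) ->
  itg a b f = itg a b g.
Proof.
move=> cg fg; have /integrableP[/measurable_EFinP mg _] := integrable_within cg.
have {}mg : measurable_fun `]a, b[ g.
  by apply: measurable_funS mg => //; exact: subset_itv_oo_cc.
have mf : measurable_fun `]a, b[ f.
  by apply: eq_measurable_fun mg => x; rewrite inE/= in_itv/= => /fg.
by congr fine; apply: eq_integral_itv_bounded => // x /[!in_itv]/= /fg.
Qed.

Lemma FTC a b F f : a <= b ->
  {within `[a, b], continuous F} -> {within `[a, b], continuous f} ->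
  (forall x, a < x < b -> is_derive x (1 : R) F (f x)) ->
  itg a b f = F b - F a.
Proof.
rewrite le_eqVlt => /predU1P[<-|ab] cF cf dF.
  by rewrite /itg set_itv1 Rintegral_set1 subrr.
rewrite /itg /Rintegral (@continuous_FTC2 _ f F)//.
  have [_ Fa Fb] := (continuous_within_itvP _ ab).1 cF.
  by split => // x; rewrite in_itv/= => /dF [].
by move=> x; rewrite in_itv/= => /dF []? <-; rewrite derive1E.
Qed.

End compact_interval.

Section pointwise_derivatives.
Context {R : realType}.
Implicit Types (f g : R -> R) (x a b : R).

Lemma is_derive_fct_cst x a : is_derive x 1 (fun=> a) 0.
Proof. exact: is_derive_cst. Qed.

Lemma is_derive_fctD f g x a b : is_derive x 1 f a -> is_derive x 1 g b ->
  is_derive x 1 (fun y => f y + g y) (a + b).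
Proof. by move=> df dg; exact: is_deriveD. Qed.

Lemma is_derive_fctN f x a : is_derive x 1 f a ->
  is_derive x 1 (fun y => - f y) (- a).
Proof. by move=> df; exact: is_deriveN. Qed.

Lemma is_derive_fctB f g x a b : is_derive x 1 f a -> is_derive x 1 g b ->
  is_derive x 1 (fun y => f y - g y) (a - b).
Proof. by move=> df dg; exact: is_deriveB. Qed.

Lemma is_derive_fctM f g x a b : is_derive x 1 f a -> is_derive x 1 g b ->
  is_derive x 1 (fun y => f y * g y) (a * g x + f x * b).
Proof.
move=> df dg; rewrite (_ : _ + _ = f x *: b + g x *: a); first exact: is_deriveM.
by rewrite /GRing.scale/= addrC [g x * a]mulrC.
Qed.

Lemma is_derive_fctZ f x a c : is_derive x 1 f a ->
  is_derive x 1 (fun y => c * f y) (c * a).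
Proof.
move=> df; rewrite (_ : c * a = 0 * f x + c * a); last by rewrite mul0r add0r.
exact: is_derive_fctM (is_derive_fct_cst x c) df.
Qed.

Lemma is_derive_fctX f n x a : is_derive x 1 f a ->
  is_derive x 1 (fun y => f y ^+ n.+1) (n.+1%:R * f x ^+ n * a).
Proof.
move=> df; elim: n => [|n ih]; first by rewrite expr0 !mul1r.
rewrite (_ : _ * a = a * f x ^+ n.+1 + f x * (n.+1%:R * f x ^+ n * a)).
  by under eq_fun do rewrite exprS; exact: is_derive_fctM.
by rewrite [n.+2%:R]mulrS exprS; ring.
Qed.

Lemma is_derive_fctV f x a : f x != 0 -> is_derive x 1 f a ->
  is_derive x 1 (fun y => (f y)^-1) (- a / f x ^+ 2).
Proof.
move=> f0 df; rewrite (_ : - a / _ = - f x ^- 2 *: a); first exact: is_deriveV.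
by rewrite /GRing.scale/= !mulNr mulrC.
Qed.

Lemma is_derive_fct_comp f g x a b : is_derive (f x) 1 g a ->
  is_derive x 1 f b -> is_derive x 1 (fun y => g (f y)) (a * b).
Proof. by move=> dg df; exact: is_derive1_comp. Qed.

Lemma is_derive_fct_exp f x a : is_derive x 1 f a ->
  is_derive x 1 (fun y => expR (f y)) (expR (f x) * a).
Proof. by move=> df; apply: is_derive_fct_comp df; exact: is_derive_expR. Qed.

Lemma is_derive_continuous f x a : is_derive x 1 f a -> {for x, continuous f}.
Proof. by move=> [df _]; apply/differentiable_continuous/derivable1_diffP. Qed.

Lemma is_derive_within f df (a b : R) :
  (forall x, a <= x <= b -> is_derive x 1 f (df x)) ->
  {within `[a, b], continuous f}.
Proof.
move=> H; apply: derivable_within_continuous => x; rewrite in_itv/= => /H.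
by case.
Qed.

Lemma within_oo_continuous f (a b x : R) : {within `[a, b], continuous f} ->
  a < x < b -> {for x, continuous f}.
Proof.
move=> cf /andP[ax xb]; have ab := lt_trans ax xb.
have [cf' _ _] := (continuous_within_itvP f ab).1 cf.
by apply: cf'; rewrite in_itv/= ax.
Qed.

Lemma is_derive_primitive f (a b x : R) : {within `[a, b], continuous f} ->
  a < x < b ->
  is_derive x 1 (fun y => itg a y f) (f x).
Proof.
move=> cf axb; have /andP[ax xb] := axb.
have [] := continuous_FTC1_closed xb (integrable_within cf) ax
  (within_oo_continuous cf axb).
by rewrite derive1E => ? <-.
Qed.

Lemma within_primitive f (a b : R) : a <= b -> {within `[a, b], continuous f} ->
  {within `[a, b], continuous
    (fun y => itg a y f)}.
Proof.
move=> ab cf; apply: parameterized_integral_continuous => //.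
exact: integrable_within.
Qed.

Lemma nonincreasing_of_derive f df (a b : R) : a <= b ->
  {within `[a, b], continuous f} ->
  (forall x, a < x < b -> is_derive x 1 f (df x)) ->
  (forall x, a < x < b -> df x <= 0) -> f b <= f a.
Proof.
move=> ab cf df1 df0.
apply: (@ler0_derive1_nincr _ f a b) => // x; rewrite in_itv/= => xab.
  by have [] := df1 x xab.
by have [? E] := df1 x xab; rewrite derive1E E; exact: df0.
Qed.

(** The primitive is squeezed between 0 and the total integral, hence constant,
    and the integrand is its derivative. *)
Lemma int_eq0_oo f (a b : R) : {within `[a, b], continuous f} ->
  (forall x, a <= x <= b -> 0 <= f x) ->
  itg a b f <= 0 ->
  forall x, a < x < b -> f x = 0.
Proof.
move=> cf f0 If x xab; have /andP[ax xb] := xab; have ab := ltW (lt_trans ax xb).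
pose F y := itg a y f.
have cF : {within `[a, b], continuous F} by exact: within_primitive.
have F0 y : a <= y <= b -> F y = 0.
  move=> /andP[ay yb]; apply/eqP; rewrite eq_le; apply/andP; split; last first.
    apply: int_ge0 => z /andP[az zy].
    by apply: f0; rewrite az (le_trans zy yb).
  apply: le_trans If; rewrite -[_ <= _]lerN2.
  apply: (@nonincreasing_of_derive (fun y => - F y) (fun y => - f y)) => //.
  - apply: within_opp; apply: continuous_subspaceW cF.
    by apply: subset_itvr; rewrite bnd_simp.
  - move=> z /andP[yz zb]; apply: is_derive_fctN.
    by apply: is_derive_primitive cf _; rewrite (le_lt_trans ay yz).
  - move=> z /andP[yz zb]; rewrite oppr_le0; apply: f0.
    by rewrite (ltW (le_lt_trans ay yz)) ltW.
have dF := is_derive_primitive cf xab.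
have d0 : is_derive x 1 F 0.
  apply: near_eq_is_derive (is_derive_fct_cst x 0).
  near=> y; rewrite F0//; apply/andP; split; near: y.
  - by apply: filterS (lt_nbhsr ax) => y /ltW.
  - by apply: filterS (lt_nbhsl xb) => y /ltW.
by have [_ <-] := dF; have [_ ->] := d0.
Unshelve. all: by end_near. Qed.

(** The growth is compared with [expR (K * t)], which stays bounded as [t]
    decreases to 0; so a vanishing limit at 0 propagates forward. *)
Lemma gronwall_from_zero (J J' : R -> R) (K T : R) : 0 <= K ->
  (forall s : R, 0 < s -> is_derive s 1 J (J' s)) ->
  (forall s, 0 < s <= T -> J' s <= K * J s) ->
  (forall s, 0 < s -> 0 <= J s) ->
  (forall e, 0 < e -> \forall s \near 0^'+, J s < e) ->
  0 < T -> J T <= 0.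
Proof.
move=> K0 dJ J'le J0 Jlim T0.
apply/ler_addgt0Pr => e e0; rewrite add0r.
have : \forall s \near 0^'+, [/\ 0 < s, s < T & J s < e * expR (- K * T)].
  near=> s; split; near: s; [exact: nbhs_right_gt|exact: nbhs_right_lt|].
  by apply: Jlim; rewrite mulr_gt0 ?expR_gt0.
move=> /filter_ex[s [s0 sT Js]].
have dG z : s <= z <= T -> is_derive z 1 (fun z => expR (- K * z) * J z)
    (expR (- K * z) * - K * J z + expR (- K * z) * J' z).
  move=> /andP[sz _]; have z0 := lt_le_trans s0 sz.
  apply: is_derive_fctM (dJ z z0); apply: is_derive_fct_exp.
  by apply: is_derive_eq (is_derive_fctZ (- K) (is_derive_id z 1)) _; rewrite mulr1.
have := @nonincreasing_of_derive _ _ s T (ltW sT) (is_derive_within dG) _ _.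
move=> /(_ (fun z => expR (- K * z) * - K * J z + expR (- K * z) * J' z)) H.
have {}H : expR (- K * T) * J T <= expR (- K * s) * J s.
  apply: H => z /andP[sz zT]; first by apply: dG; rewrite (ltW sz) ltW.
  have z0 := lt_trans s0 sz.
  rewrite -mulrA -mulrDr pmulr_rle0 ?expR_gt0// mulNr addrC subr_le0.
  by apply: J'le; rewrite z0 ltW.
have Es : expR (- K * s) * J s <= J s.
  rewrite ler_piMl ?J0// -expR0 ler_expR mulNr oppr_le0 mulr_ge0//.
  exact: ltW.
have := le_lt_trans (le_trans H Es) Js; rewrite mulrC ltr_pM2r ?expR_gt0//.
exact: ltW.
Unshelve. all: by end_near. Qed.

End pointwise_derivatives.

Section more_integrals.
Context {R : realType}.
Notation mu := (@lebesgue_measure R).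

Lemma int_chasles (f : R -> R) (a b c : R) : a <= c <= b ->
  {within `[a, b], continuous f} ->
  itg a b f =
  itg a c f + itg c b f.
Proof.
move=> /andP[ac cb] cf; have If := integrable_within cf.
apply/eqP; rewrite /itg addrC -subr_eq Rintegral_itvB ?bnd_simp//.
rewrite Rintegral_itv_obnd_cbnd//.
by apply: integrableS If => //; apply: subset_itvr; rewrite bnd_simp// ltW.
Qed.

Lemma within_eq0_right (f : R -> R) (a b : R) : a < b ->
  {within `[a, b], continuous f} -> (forall x, a < x < b -> f x = 0) -> f b = 0.
Proof.
move=> ab cf f0; have [_ _ fb] := (continuous_within_itvP f ab).1 cf.
apply: (cvg_unique _ fb) => //; apply: cvg_near_cst.
near=> x; rewrite f0//; apply/andP; split; near: x.
- exact: nbhs_left_gt.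
- exact: nbhs_left_lt.
Unshelve. all: by end_near. Qed.

Lemma within_bounded (f : R -> R) (a b : R) : {within `[a, b], continuous f} ->
  exists2 C, 0 < C & forall x, a <= x <= b -> `|f x| <= C.
Proof.
move=> cf.
have /compact_bounded[M [_ HM]] := continuous_compact cf (@segment_compact _ a b).
exists (`|M| + 1) => [|x xab]; first by rewrite ltr_wpDl.
apply: (HM (`|M| + 1)); first by rewrite (le_lt_trans (ler_norm _))// ltrDl.
by exists x => //=; rewrite in_itv.
Qed.

End more_integrals.

(** * Space-time functions on the closed interval *)

Section interior_derivative.
Context {R : realType}.
Implicit Types (f g : R -> R) (x l : R).

Lemma within_dnbhs_itv a b x : a < x < b -> within `[a, b] x^' = x^'.
Proof.
move=> /andP[ax xb]; apply/seteqP; split => A; last first.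
  by rewrite /within/=; apply: filterS.
rewrite /within/= => PA.
suff : \forall y \near x^', `[a, b]%classic y.
  by move: PA; apply: filterS2 => y; apply.
apply: nbhs_dnbhs.
near=> y; rewrite /= in_itv/=; apply/andP; split; near: y.
- by apply: filterS (lt_nbhsr ax) => y /ltW.
- by apply: filterS (lt_nbhsl xb) => y /ltW.
Unshelve. all: by end_near. Qed.

Lemma quotient_is_derive f x l :
  (f y - f x) / (y - x) @[y --> x^'] --> l <-> is_derive x 1 f l.
Proof.
have E : ((f y - f x) / (y - x) @[y --> x^'] --> l) <->
         (h^-1 *: (f (h *: 1 + x) - f x) @[h --> 0^'] --> l).
  split=> /cvgrPdist_lt H; apply/cvgrPdist_lt => e /H; rewrite !near_withinE.
  - move=> /nbhs_ballP[d d0 Hd]; apply/nbhs_ballP; exists d => // h bh h0.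
    have := Hd (h + x); rewrite /ball/= opprD addrCA subrr addr0 normrN.
    rewrite -[h + x == x]subr_eq0 addrK.
    move: bh; rewrite /ball/= sub0r normrN => -> /(_ isT h0).
    by rewrite /GRing.scale/= mulr1 mulrC.
  - move=> /nbhs_ballP[d d0 Hd]; apply/nbhs_ballP; exists d => // y xy yx.
    have := Hd (y - x); rewrite /ball/= sub0r normrN distrC.
    move: xy; rewrite /ball/= => -> /(_ isT); rewrite subr_eq0 => /(_ yx).
    by rewrite /GRing.scale/= mulr1 subrK mulrC.
rewrite E; split=> [H|[df <-]]; last exact: df.
by split; [apply/cvg_ex; exists l|exact: cvg_lim].
Qed.

(** Inside the interval the restriction to it is invisible, so [dI] is the
    ordinary derivative. This is enough for all integral identities, in which
    the endpoints form a null set. *)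
Lemma is_derive_dI f x : -1 < x < 1 -> derivableI f x -> is_derive x 1 f (dI f x).
Proof.
move=> x1 df; apply/quotient_is_derive; rewrite -(within_dnbhs_itv x1).
exact: df.
Qed.

Lemma dI_is_derive f x l : -1 < x < 1 -> is_derive x 1 f l -> dI f x = l.
Proof.
move=> x1 /quotient_is_derive df; rewrite /dI /diffquotI within_dnbhs_itv//.
exact: cvg_lim.
Qed.

End interior_derivative.

Section space_time.
Context {R : realType}.
Notation mu := (@lebesgue_measure R).
Implicit Types (u v ut : R -> R -> R) (a b x t s : R).

Lemma contQ_slice u t : contQ u -> 0 < t ->
  {within `[-1, 1], continuous (u ^~ t)}.
Proof.
move=> /subspace_continuousP cu t0; apply/subspace_continuousP => x x1.
have {}cu := cu (x, t) _; rewrite /= in cu.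
apply: (cvg_comp (fun y => (y, t)) (fun z => u z.1 z.2)) (cu _); last first.
  by split => //=; rewrite ?in_itv/= ?t0.
move=> A; rewrite /within/= => -[[B1 B2]/= [HB1 HB2] BA].
apply: filterS HB1 => y By y1; apply: (BA (y, t)) => /=.
  by split => //; exact: nbhs_singleton HB2.
by split => //=; rewrite ?in_itv/= ?t0.
Qed.

Lemma contQ_space (f : R -> R) : {within `[-1, 1], continuous f} ->
  contQ (fun x _ => f x).
Proof.
move=> /subspace_continuousP cf; apply/subspace_continuousP => -[x t] [/= x1 t0].
apply: (cvg_comp (@fst R R) f) (cf x x1) => A; rewrite /within/= => HA.
exists ([set y | `[-1, 1]%classic y -> A y], setT) => /=.
  by split => //; exact: filterT.
by move=> [y s]/= [yA _] [y1 _]; exact: yA.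
Qed.

Definition locally_boundedQ u := forall a b : R, 0 < a ->
  exists C : R, forall x t, -1 <= x <= 1 -> a <= t <= b -> `|u x t| <= C.

Lemma contQ_bounded u : contQ u -> locally_boundedQ u.
Proof.
move=> cu a b a0.
have sub : (`[-1, 1] `*` `[a, b] : set (R * R)) `<=` `[-1, 1] `*` `]0, +oo[.
  move=> [x t] [/= x1]; rewrite !in_itv/= => /andP[ta _].
  by split => //=; rewrite ?in_itv/= (lt_le_trans a0 ta).
have cA : compact (`[-1, 1] `*` `[a, b] : set (R * R)).
  by apply: compact_setX; exact: segment_compact.
have := continuous_compact (continuous_subspaceW sub cu) cA.
move=> /compact_bounded[M [_ HM]]; exists (M + 1) => x t x1 tab.
apply: (HM (M + 1)); first by rewrite ltrDl.
by exists (x, t) => //; split => /=; rewrite in_itv.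
Qed.

Lemma locally_boundedQM u v : locally_boundedQ u -> locally_boundedQ v ->
  locally_boundedQ (fun x t => u x t * v x t).
Proof.
move=> bu bv a b a0; have [C HC] := bu a b a0; have [K HK] := bv a b a0.
exists (C * K) => x t x1 tab; rewrite normrM.
by apply: ler_pM => //; [exact: HC|exact: HK].
Qed.

Lemma locally_boundedQD u v : locally_boundedQ u -> locally_boundedQ v ->
  locally_boundedQ (fun x t => u x t + v x t).
Proof.
move=> bu bv a b a0; have [C HC] := bu a b a0; have [K HK] := bv a b a0.
exists (C + K) => x t x1 tab; apply: le_trans (ler_normD _ _) _.
by apply: lerD; [exact: HC|exact: HK].
Qed.

(** Local boundedness of the time derivative is the domination under which
    differentiation and integration commute. *)
Lemma is_derive_int u ut a b t : -1 <= a -> b <= 1 ->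
  (forall s, 0 < s -> {within `[-1, 1], continuous (u ^~ s)}) ->
  (forall x s, -1 <= x <= 1 -> 0 < s -> is_derive s 1 (u x) (ut x s)) ->
  locally_boundedQ ut -> 0 < t ->
  is_derive t 1 (fun s => itg a b (fun x => u x s))
    (itg a b (fun x => ut x t)).
Proof.
move=> a1 b1 cu du bu t0.
have sub : `[a, b] `<=` `[-1, 1] by apply: subset_itvScc.
have [C HC] := bu (t / 2) (2 * t) (divr_gt0 t0 (ltr0Sn _ _)).
have It : `]t / 2, 2 * t[%classic t by rewrite /= in_itv/=; apply/andP; split; lra.
have I0 s : `]t / 2, 2 * t[%classic s -> 0 < s.
  by rewrite /= in_itv/= => /andP[+ _]; apply: lt_trans; exact: divr_gt0.
have sub1 x : `[a, b]%classic x -> -1 <= x <= 1.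
  by move=> /sub; rewrite /= in_itv.
have inu s : `]t / 2, 2 * t[%classic s -> mu.-integrable `[a, b] (EFin \o (u ^~ s)).
  move=> /I0 s0; apply: integrable_within.
  exact: continuous_subspaceW sub (cu s s0).
have dru s x : `]t / 2, 2 * t[%classic s -> `[a, b]%classic x ->
    derivable (u x) s 1.
  by move=> /I0 s0 /sub1 x1; have [] := du x s x1 s0.
have E x s : `[a, b]%classic x -> 0 < s -> derive1 (u x) s = ut x s.
  by move=> /sub1 x1 s0; have [] := du x s x1 s0; rewrite derive1E.
have iG : mu.-integrable `[a, b] (EFin \o cst `|C|).
  by apply: integrable_within; exact: within_cst.
have Gub s x : `]t / 2, 2 * t[%classic s -> `[a, b]%classic x ->
    `|partial1of2 (fun s x => u x s) s x| <= cst `|C| x.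
  move=> Is xab; rewrite /partial1of2 (E x s xab (I0 s Is)) /=.
  apply: le_trans (ler_norm C); apply: HC; first exact: sub1.
  by move: Is; rewrite /= in_itv/= => /andP[/ltW -> /ltW ->].
have mab : measurable (`[a, b] : set R) by [].
have := @derivable_under_integral _ _ _ mu (fun s x => u x s) _ mab t _ _ It
  inu dru _ (fun=> normr_ge0 C) iG Gub.
have := @differentiation_under_integral _ _ _ mu (fun s x => u x s) _ mab t _ _ It
  inu dru _ (fun=> normr_ge0 C) iG Gub.
rewrite /= derive1E => Ed dd; split => //; rewrite Ed.
apply: eq_Rintegral => x; rewrite inE => xab.
by rewrite /partial1of2 E.
Qed.

End space_time.

(** * Square integrable initial data *)

Section square_integrable.
Context {R : realType}.
Notation mu := (@lebesgue_measure R).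
Implicit Types (f g : R -> R) (x t e s : R).

Definition sq_integrable f :=
  measurable_fun (`[-1, 1] : set R) f /\
  mu.-integrable `[-1, 1] (EFin \o (fun x => f x ^+ 2)).

Lemma measurable_within f (a b : R) : {within `[a, b], continuous f} ->
  measurable_fun (`[a, b] : set R) f.
Proof. by move=> /integrable_within /integrableP[/measurable_EFinP]. Qed.

Lemma sq_integrable_within f : {within `[-1, 1], continuous f} -> sq_integrable f.
Proof.
by move=> cf; split; [exact: measurable_within|exact: integrable_within (within_exp 2 cf)].
Qed.

Lemma integrable_fctD f g : mu.-integrable `[-1, 1] (EFin \o f) ->
  mu.-integrable `[-1, 1] (EFin \o g) ->
  mu.-integrable `[-1, 1] (EFin \o (fun x => f x + g x)).
Proof.
move=> If Ig; rewrite (_ : EFin \o _ = ((EFin \o f) \+ (EFin \o g))%E).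
  exact: integrableD.
by apply/funext => x; rewrite /= EFinD.
Qed.

Let intZ f c : mu.-integrable `[-1, 1] (EFin \o f) ->
  mu.-integrable `[-1, 1] (EFin \o (fun x => c * f x)).
Proof.
move=> If; rewrite (_ : EFin \o _ = (fun x => c%:E * (EFin \o f) x)%E).
  exact: integrableZl.
by apply/funext => x; rewrite /= EFinM.
Qed.

Let dominated f g : measurable_fun (`[-1, 1] : set R) f ->
  (forall x, `|f x| <= `|g x|) ->
  mu.-integrable `[-1, 1] (EFin \o g) -> mu.-integrable `[-1, 1] (EFin \o f).
Proof.
move=> mf fg; apply: le_integrable => //; first exact/measurable_EFinP.
by move=> x _; rewrite /= lee_fin.
Qed.

Lemma sq_integrableD f g : sq_integrable f -> sq_integrable g ->
  sq_integrable (fun x => f x + g x).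
Proof.
move=> [mf If] [mg Ig]; split; first exact: measurable_funD.
apply: (@dominated _ (fun x => 2 * f x ^+ 2 + 2 * g x ^+ 2)).
- by apply: measurable_funX; exact: measurable_funD.
- move=> x; rewrite !ger0_norm ?sqr_ge0//.
    have : 0 <= (f x - g x) ^+ 2 by exact: sqr_ge0.
    lra.
  by rewrite addr_ge0// mulr_ge0// sqr_ge0.
- exact: integrable_fctD (intZ 2 If) (intZ 2 Ig).
Qed.

Lemma sq_integrableZ f c : sq_integrable f -> sq_integrable (fun x => c * f x).
Proof.
move=> [mf If]; split; first by apply: measurable_funM => //; exact: measurable_cst.
rewrite (_ : (fun x => (c * f x) ^+ 2) = (fun x => c ^+ 2 * f x ^+ 2)).
  exact: intZ.
by apply/funext => x; rewrite exprMn.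
Qed.

Lemma sq_integrableB f g : sq_integrable f -> sq_integrable g ->
  sq_integrable (fun x => f x - g x).
Proof.
move=> sf sg; rewrite (_ : (fun x => f x - g x) = (fun x => f x + -1 * g x)).
  exact: sq_integrableD sf (sq_integrableZ (-1) sg).
by apply/funext => x; rewrite mulN1r.
Qed.

Lemma sq_integrable_integrable f : sq_integrable f ->
  mu.-integrable `[-1, 1] (EFin \o f).
Proof.
move=> [mf If]; apply: (@dominated _ (fun x => f x ^+ 2 + 1)) => //.
  move=> x; rewrite [leRHS]ger0_norm ?addr_ge0 ?sqr_ge0//.
  rewrite -real_normK ?num_real//.
  have : 0 <= (`|f x| - 1) ^+ 2 by exact: sqr_ge0.
  have : 0 <= `|f x| by [].
  rewrite sqrrB expr1n mulr1; lra.
have I1 : mu.-integrable `[-1, 1] (EFin \o (fun=> 1 : R)).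
  by apply: integrable_within; exact: within_cst.
exact: integrable_fctD.
Qed.

(** Young's inequality with a free weight [s], in place of the Cauchy-Schwarz
    inequality: choosing [s] small first makes the left side small with the
    integral of the square. *)
Lemma int_norm_le_sqr f s : 0 < s -> sq_integrable f ->
  itg (-1) 1 (fun x => `|f x|) <= s + itg (-1) 1 (fun x => f x ^+ 2) / (2 * s).
Proof.
move=> s0 sf; have If := sq_integrable_integrable sf; have [mf I2] := sf.
have Is : mu.-integrable `[-1, 1] (EFin \o (fun=> s / 2 : R)).
  by apply: integrable_within; exact: within_cst.
have I2s : mu.-integrable `[-1, 1] (EFin \o (fun x => (2 * s)^-1 * f x ^+ 2)).
  exact: intZ.
have : itg (-1) 1 (fun x => `|f x|) <= itg (-1) 1 (fun x => s / 2 + (2 * s)^-1 * f x ^+ 2).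
  apply: le_Rintegral => //.
  - by apply: integrable_norm If.
  - exact: integrable_fctD.
  - move=> x _; rewrite -(real_normK (num_real (f x))) -subr_ge0.
    rewrite (_ : _ - _ = (`|f x| - s) ^+ 2 / (2 * s)); last by field; rewrite gt_eqF.
    by rewrite divr_ge0 ?sqr_ge0// mulr_ge0// ltW.
have -> : itg (-1) 1 (fun x => s / 2 + (2 * s)^-1 * f x ^+ 2) =
    itg (-1) 1 (fun=> s / 2) + itg (-1) 1 (fun x => (2 * s)^-1 * f x ^+ 2).
  exact: RintegralD.
have -> : itg (-1) 1 (fun x => (2 * s)^-1 * f x ^+ 2) =
    (2 * s)^-1 * itg (-1) 1 (fun x => f x ^+ 2).
  exact: RintegralZl.
rewrite int_cst; last by rewrite (le_trans (lerN10 R)).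
by rewrite opprK mulrC [_^-1 * _]mulrC (_ : (1 + 1) * (s / 2) = s)//; field.
Qed.

Lemma in_L2_sq_integrable f : in_L2 f -> sq_integrable f.
Proof.
rewrite /in_L2 => H; have I2 := Lfun2_integrable_sqr H.
have mO : measurable (`]-1, 1[ : set R) by [].
have mf : measurable_fun (`]-1, 1[ : set R) f.
  apply/(measurable_restrictT f mO).
  by move: H; rewrite inE => /andP[]; rewrite inE.
have mf2 : measurable_fun (`]-1, 1[ : set R) (fun x => f x ^+ 2).
  exact: measurable_funX.
split; first exact: measurable_fun_itv_cc mf.
have IO : mu.-integrable `]-1, 1[ (EFin \o (fun x => f x ^+ 2)).
  have K := @integrable_mkcond _ _ R mu `]-1, 1[%classic (EFin \o (fun x => f x ^+ 2)) mO.
  apply K.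
  rewrite restrict_EFin.
  rewrite (_ : _ \_ _ = (fun x => (f \_ `]-1, 1[) x ^+ 2)) //.
  by apply/funext => x; rewrite !patchE; case: ifPn => // _; rewrite expr0n.
apply/integrableP; split.
  by apply/measurable_EFinP; apply: measurable_fun_itv_cc mf2.
rewrite integral_itv_bndoo; last by apply: measurableT_comp => //; apply/measurable_EFinP.
by move/integrableP : IO => [].
Qed.

Lemma L2norm_lt f e : 0 < e -> sq_integrable f -> (L2norm f < e%:E)%E ->
  itg (-1) 1 (fun x => f x ^+ 2) < e ^+ 2.
Proof.
move=> e0 [mf If] fe.
have mO : measurable (`]-1, 1[ : set R) by [].
have E : (L2norm f `^ 2%R)%E = (\int[mu]_(x in `[(-1)%R, 1%R]) (f x ^+ 2)%:E)%E.
  pose fO := f \_ `]-1, 1[.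
  rewrite /L2norm poweR_Lnorm// integral_itv_bndoo; last first.
    apply/measurable_EFinP; apply: measurable_funX.
    by apply: measurable_funS mf => //; exact: subset_itv_oo_cc.
  rewrite [RHS]integral_mkcond; apply: eq_integral => x _ /=.
  rewrite -[LHS]/(`|fO x|%R%:E `^ 2%R)%E.
  rewrite poweR_EFin powR_mulrn// real_normK ?num_real// /fO !patchE.
  by case: ifPn => // _; rewrite expr0n.
have n0 : (0 <= L2norm f)%E by exact: Lnorm_ge0.
rewrite /itg /Rintegral -E.
case: (L2norm f) n0 fe => [n| |]//; rewrite lee_fin lte_fin => n0 ne.
by rewrite poweR_EFin powR_mulrn//= ltrXn2r// ltW.
Qed.

Lemma L2_cvg_sqr (f : R -> R -> R) :
  (forall t, 0 < t -> {within `[-1, 1], continuous (f ^~ t)}) ->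
  sq_integrable (f ^~ 0) ->
  L2norm (fun x => f x t - f x 0) @[t --> 0^'+] --> 0%E ->
  forall e, 0 < e ->
    \forall t \near 0^'+, itg (-1) 1 (fun x => (f x t - f x 0) ^+ 2) < e.
Proof.
move=> cf f0 /fine_cvgP[fin /cvgrPdist_lt H] e e0.
have s0 : 0 < Num.sqrt e by rewrite sqrtr_gt0.
have {}H := H _ s0; near=> t.
have t0 : 0 < t by near: t; exact: nbhs_right_gt.
rewrite -(sqr_sqrtr (ltW e0)); apply: L2norm_lt => //.
  exact: sq_integrableB (sq_integrable_within (cf t t0)) f0.
have tf : L2norm (fun x => f x t - f x 0) \is a fin_num by near: t.
have : `|0 - (fine \o (fun t => L2norm (fun x => f x t - f x 0))) t| < Num.sqrt e.
  by near: t.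
rewrite /= sub0r normrN => /(le_lt_trans (ler_norm _)) h.
by rewrite -(fineK tf) lte_fin.
Unshelve. all: by end_near. Qed.

Lemma L2_cvg_norm (f : R -> R -> R) :
  (forall t, 0 < t -> {within `[-1, 1], continuous (f ^~ t)}) ->
  sq_integrable (f ^~ 0) ->
  L2norm (fun x => f x t - f x 0) @[t --> 0^'+] --> 0%E ->
  forall e, 0 < e ->
    \forall t \near 0^'+, itg (-1) 1 (fun x => `|f x t - f x 0|) < e.
Proof.
move=> cf f0 lim e e0; have e2 : 0 < e / 2 by rewrite divr_gt0.
have e3 : 0 < e ^+ 2 / 2 by rewrite divr_gt0// exprn_gt0.
have H := L2_cvg_sqr cf f0 lim e3; near=> t.
have t0 : 0 < t by near: t; exact: nbhs_right_gt.
have sf := sq_integrableB (sq_integrable_within (cf t t0)) f0.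
apply: le_lt_trans (int_norm_le_sqr e2 sf) _.
have h : itg (-1) 1 (fun x => (f x t - f x 0) ^+ 2) < e ^+ 2 / 2 by near: t.
rewrite (_ : 2 * (e / 2) = e); last by field.
rewrite [ltRHS](_ : e = e / 2 + (e ^+ 2 / 2) / e); last by field; rewrite gt_eqF.
by rewrite ltrD2l ltr_pM2r// invr_gt0.
Unshelve. all: by end_near. Qed.

Lemma primitive_dist f g x : -1 <= x <= 1 ->
  mu.-integrable `[-1, 1] (EFin \o f) -> mu.-integrable `[-1, 1] (EFin \o g) ->
  `|itg (-1) x f - itg (-1) x g| <= itg (-1) 1 (fun x => `|f x - g x|).
Proof.
move=> /andP[x1 x2] If Ig.
have sub : (`[-1, x] : set R) `<=` `[-1, 1] by apply: subset_itvl; rewrite bnd_simp.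
have IS h : mu.-integrable `[-1, 1] (EFin \o h) ->
    mu.-integrable `[-1, x] (EFin \o h).
  by move=> Ih; apply: integrableS Ih.
have -> : itg (-1) x f - itg (-1) x g = itg (-1) x (fun x => f x - g x).
  by rewrite /itg RintegralB//; exact: IS.
have Ifg : mu.-integrable `[-1, 1] (EFin \o (fun x => f x - g x)).
  rewrite (_ : (fun x => f x - g x) = (fun x => f x + -1 * g x)).
    exact: integrable_fctD If (intZ (-1) Ig).
  by apply/funext => y; rewrite mulN1r.
have In : mu.-integrable `[-1, 1] (EFin \o (fun x => `|f x - g x|)).
  exact: integrable_norm Ifg.
apply: (@le_trans _ _ (itg (-1) x (fun x => `|f x - g x|))).
  by apply: le_normr_Rintegral => //; exact: IS.
have := Rintegral_itvB (x := x) In; rewrite !bnd_simp => /(_ x1 x2) E.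
rewrite -subr_ge0 /itg E; apply: Rintegral_ge0 => y _; exact: normr_ge0.
Qed.

End square_integrable.

(** * Positivity for drift-diffusion equations without boundary flux *)

Section negative_part_energy.
Context {R : realType}.
Implicit Types (s u x t : R).

Definition negpart s : R := Num.max 0 (- s).

Lemma negpart_ge0 s : 0 <= negpart s.
Proof. by rewrite /negpart le_max lexx. Qed.

Lemma negpart_continuous : continuous negpart.
Proof.
move=> s; apply: (@continuous_max _ _ (fun=> 0) (fun y => - y)).
  exact: cvg_cst.
by apply: cvgN; exact: cvg_id.
Qed.

Lemma negpart_le_dist s a : 0 <= a -> negpart s <= `|s - a|.
Proof.
move=> a0; rewrite /negpart ge_max normr_ge0/= distrC.
by apply: le_trans (ler_norm _); rewrite lerDr.
Qed.

(** Composing with the negative part keeps differentiability at the kink as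
    soon as the outer function is flat at 0. *)
Lemma is_derive_negpart (k k' : R -> R) s :
  (forall u, 0 <= u -> is_derive u 1 k (k' u)) -> k' 0 = 0 ->
  is_derive s 1 (fun y => k (negpart y)) (- k' (negpart s)).
Proof.
move=> dk k'0; have [s0|s0|->] := ltgtP s 0.
- have E y : y <= 0 -> negpart y = - y by move=> y0; rewrite /negpart max_r// oppr_ge0.
  apply: (@near_eq_is_derive _ _ _ (fun y => k (- y))).
    by apply: filterS (lt_nbhsl s0) => y /ltW /E ->.
  rewrite E ?ltW// -[X in is_derive _ _ _ X]mulrN1.
  by apply: is_derive_fct_comp; first by apply: dk; rewrite oppr_ge0 ltW.
- have E y : 0 <= y -> negpart y = 0 by move=> y0; rewrite /negpart max_l// oppr_le0.
  rewrite E ?ltW// k'0 oppr0.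
  apply: near_eq_is_derive (is_derive_fct_cst s (k 0)).
  by apply: filterS (lt_nbhsr s0) => y /ltW /E ->.
- have E0 : negpart 0 = 0 by rewrite /negpart oppr0 maxxx.
  rewrite E0 k'0 oppr0; apply/quotient_is_derive/cvgrPdist_lt => e e0.
  have := dk 0 (lexx _); rewrite k'0 => /quotient_is_derive/cvgrPdist_lt/(_ e e0).
  rewrite !near_withinE => /nbhs_ballP[d d0 Hd]; apply/nbhs_ballP; exists d => //.
  move=> y; rewrite /ball/= sub0r normrN => yd y0; rewrite E0 !sub0r subr0 normrN.
  have [yn|yp] := ltP y 0; last first.
    by rewrite (_ : negpart y = 0) ?subrr ?mul0r ?normr0// /negpart max_l// oppr_le0.
  have -> : negpart y = - y by rewrite /negpart max_r// oppr_ge0 ltW.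
  have := Hd (- y); rewrite /ball/= sub0r opprK => /(_ yd); rewrite oppr_eq0.
  by move=> /(_ y0); rewrite sub0r normrN subr0 invrN mulrN normrN.
Qed.

(** A smooth substitute for the squared negative part: cubic at 0, so twice
    differentiable, yet of quadratic growth, so finite on square-integrable
    data. *)
Definition negcost s : R := negpart s ^+ 3 / (1 + negpart s).
Definition dnegcost s : R :=
  - ((3 * negpart s ^+ 2 + 2 * negpart s ^+ 3) / (1 + negpart s) ^+ 2).
Definition ddnegcost s : R :=
  (6 * negpart s + 6 * negpart s ^+ 2 + 2 * negpart s ^+ 3) / (1 + negpart s) ^+ 3.

Let onep u : 0 <= u -> 0 < 1 + u. Proof. by move=> u0; lra. Qed.
Let onen0 u : 0 <= u -> 1 + u != 0. Proof. by move=> /onep/gt_eqF ->. Qed.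

Let dpow n u : is_derive u 1 (fun y : R => y ^+ n.+1) (n.+1%:R * u ^+ n).
Proof.
by have := is_derive_fctX n (is_derive_id u 1); rewrite mulr1.
Qed.

Let d1p u : is_derive u 1 (fun y : R => 1 + y) 1.
Proof.
by have := is_derive_fctD (is_derive_fct_cst u 1) (is_derive_id u 1); rewrite add0r.
Qed.

Lemma is_derive_negcost s : is_derive s 1 negcost (dnegcost s).
Proof.
apply: (@is_derive_negpart (fun u => u ^+ 3 / (1 + u))
  (fun u => (3 * u ^+ 2 + 2 * u ^+ 3) / (1 + u) ^+ 2)) => [u u0|].
  have := is_derive_fctM (dpow 2 u) (is_derive_fctV (onen0 u0) (d1p u)).
  by move/is_derive_eq; apply; field; exact: onen0.
by rewrite !expr0n/= !mulr0 addr0 mul0r.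
Qed.

Lemma is_derive_dnegcost s : is_derive s 1 dnegcost (ddnegcost s).
Proof.
rewrite -[ddnegcost s]opprK; apply: is_derive_fctN.
apply: (@is_derive_negpart (fun u => (3 * u ^+ 2 + 2 * u ^+ 3) / (1 + u) ^+ 2)
  (fun u => (6 * u + 6 * u ^+ 2 + 2 * u ^+ 3) / (1 + u) ^+ 3)) => [u u0|].
  have dn := is_derive_fctD (is_derive_fctZ 3 (dpow 1 u)) (is_derive_fctZ 2 (dpow 2 u)).
  have u2 : (1 + u) ^+ 2 != 0 by rewrite expf_neq0// onen0.
  have := is_derive_fctM dn
    (@is_derive_fctV _ (fun y => (1 + y) ^+ 2) u _ u2 (is_derive_fctX 1 (d1p u))).
  by move/is_derive_eq; apply; field; exact: onen0.
by rewrite !expr0n/= !mulr0 !addr0 mul0r.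
Qed.

Lemma negcost_continuous : continuous negcost.
Proof. by move=> s; exact: is_derive_continuous (is_derive_negcost s). Qed.

Lemma dnegcost_continuous : continuous dnegcost.
Proof. by move=> s; exact: is_derive_continuous (is_derive_dnegcost s). Qed.

Lemma ddnegcost_continuous : continuous ddnegcost.
Proof.
have c := negpart_continuous => s.
have cX n : negpart y ^+ n @[y --> s] --> negpart s ^+ n.
  apply: (@cvg_comp _ _ _ negpart (fun y => y ^+ n) _ _ _ (c s)).
  exact: exprn_continuous.
apply: cvgM.
  apply: cvgD; last by apply: cvgM; [exact: cvg_cst|exact: cX].
  apply: cvgD; apply: cvgM; (try exact: cvg_cst); [exact: c|exact: cX].
apply: cvgV; first by rewrite expf_neq0// onen0// negpart_ge0.
apply: (@cvg_comp _ _ _ (fun y => 1 + negpart y) (fun z => z ^+ 3)).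
  by apply: cvgD; [exact: cvg_cst|exact: c].
exact: exprn_continuous.
Qed.

Lemma negcost_ge0 s : 0 <= negcost s.
Proof.
have u0 := negpart_ge0 s.
by rewrite divr_ge0 ?exprn_ge0// ltW// onep.
Qed.

Lemma negcost_eq0 s : negcost s = 0 -> 0 <= s.
Proof.
have u0 := negpart_ge0 s; move/eqP.
rewrite mulf_eq0 invr_eq0 (negbTE (onen0 u0)) orbF expf_eq0/= => /eqP E.
by rewrite -oppr_le0 -E /negpart le_max lexx orbT.
Qed.

(** The comparison value [a] will be the initial density at the same point, so
    convergence in [L^2] to it makes the integral of [negcost] tend to 0. *)
Lemma negcost_le_sqr s a : 0 <= a -> negcost s <= (s - a) ^+ 2.
Proof.
move=> a0; have u0 := negpart_ge0 s.
apply: (@le_trans _ _ (negpart s ^+ 2)).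
  rewrite ler_pdivrMr ?onep// exprS mulrC ler_wpM2l ?exprn_ge0//; lra.
by rewrite -[leRHS]real_normK ?num_real// lerXn2r ?nnegrE// negpart_le_dist.
Qed.

(** The drift term is absorbed by completing the square in the diffusion term. *)
Lemma ddnegcost_drift s p w : - (ddnegcost s * p * (p - s * w)) <= 2 * w ^+ 2 * negcost s.
Proof.
have u0 := negpart_ge0 s.
have [s0|s0] := leP 0 s.
  have E : negpart s = 0 by rewrite /negpart max_l// oppr_le0.
  by rewrite /ddnegcost /negcost E !expr0n/= !mulr0 !addr0 !mul0r oppr0 mulr0.
have E : s = - negpart s by rewrite /negpart max_r ?opprK// oppr_ge0 ltW.
set u := negpart s in u0 E *.
rewrite /ddnegcost /negcost -/u E.
have h : 0 <= (6 * u + 6 * u ^+ 2 + 2 * u ^+ 3) / (1 + u) ^+ 3.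
  by rewrite divr_ge0 ?exprn_ge0 ?addr_ge0 ?mulr_ge0 ?exprn_ge0// ler0n.
have k : (6 * u + 6 * u ^+ 2 + 2 * u ^+ 3) / (1 + u) ^+ 3 * u ^+ 2
    <= 6 * (u ^+ 3 / (1 + u)).
  rewrite mulrAC ler_pdivrMr ?exprn_gt0 ?onep//.
  rewrite (_ : 6 * _ * _ = 6 * (u ^+ 3 * (1 + u) ^+ 2)); last first.
    by field; exact: onen0.
  rewrite -subr_ge0 (_ : _ - _ = 6 * u ^+ 4 + 4 * u ^+ 5); last by ring.
  by rewrite addr_ge0// mulr_ge0// exprn_ge0.
set q := (X in - (X * _ * _)) in h k *; set j := (X in _ <= _ * X).
have j0 : 0 <= j by rewrite divr_ge0 ?exprn_ge0// ltW// onep.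
have -> : - (q * p * (p - - u * w))
    = - (q * (p + u * w / 2) ^+ 2) + (q * u ^+ 2) * (w ^+ 2 / 4) by field.
have h1 : 0 <= q * (p + u * w / 2) ^+ 2 by rewrite mulr_ge0 ?sqr_ge0.
have h2 : q * u ^+ 2 * (w ^+ 2 / 4) <= 6 * j * (w ^+ 2 / 4).
  by rewrite ler_wpM2r// divr_ge0 ?sqr_ge0.
have h3 : 0 <= w ^+ 2 * j by rewrite mulr_ge0 ?sqr_ge0.
by lra.
Qed.

End negative_part_energy.

(** Positivity for a drift-diffusion equation in conservation form. The flux
    vanishes at the walls, so no mass of negative part can enter, and the bounded
    drift lets it grow at most exponentially from its initial value 0. *)
Lemma drift_diffusion_ge0 (R : realType) (u ux ut G W : R -> R -> R) :
  contQ u -> contQ ux -> contQ ut -> contQ G ->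
  (forall x t : R, -1 < x < 1 -> 0 < t -> is_derive x 1 (u ^~ t) (ux x t)) ->
  (forall x t : R, -1 <= x <= 1 -> 0 < t -> is_derive t 1 (u x) (ut x t)) ->
  (forall x t : R, -1 < x < 1 -> 0 < t -> is_derive x 1 (G ^~ t) (ut x t)) ->
  (forall t : R, 0 < t -> G (-1) t = 0 /\ G 1 t = 0) ->
  (forall x t : R, -1 <= x <= 1 -> 0 < t -> G x t = ux x t - u x t * W x t) ->
  (forall T : R, exists C : R, forall x t : R, -1 <= x <= 1 -> 0 < t <= T -> `|W x t| <= C) ->
  (forall e : R, 0 < e -> \forall t \near 0^'+,
     itg (-1) 1 (fun x => negcost (u x t)) < e) ->
  forall x t : R, -1 < x < 1 -> 0 < t -> 0 <= u x t.
Proof.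
move=> cu cux cut cG dux dut dG G1 GE Wb lim0 x T x1 T0.
have [C HC] := Wb T.
have cj1 : contQ (fun x t => dnegcost (u x t) * ut x t).
  by apply: within_mul cut; apply: within_comp cu; exact: dnegcost_continuous.
pose J t := itg (-1) 1 (fun x => negcost (u x t)).
pose J' t := itg (-1) 1 (fun x => dnegcost (u x t) * ut x t).
have cj (t : R) : 0 < t -> {within `[-1, 1], continuous (fun x => negcost (u x t))}.
  move=> t0; apply: within_comp (contQ_slice cu t0); exact: negcost_continuous.
have dJ (s : R) : 0 < s -> is_derive s 1 J (J' s).
  move=> s0; apply: (@is_derive_int _ (fun x t => negcost (u x t))
    (fun x t => dnegcost (u x t) * ut x t) (-1) 1) => //.
  - move=> y r y1 r0; apply: is_derive_fct_comp (dut y r y1 r0).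
    exact: is_derive_negcost.
  - exact: contQ_bounded.
have J0 (s : R) : 0 < s -> 0 <= J s by move=> _; apply: int_ge0 => y _; exact: negcost_ge0.
have J'J (s : R) : 0 < s <= T -> J' s <= 2 * C ^+ 2 * J s.
  move=> /andP[s0 sT].
  have cus := contQ_slice cu s0; have cGs := contQ_slice cG s0.
  have cd := within_comp (@dnegcost_continuous R) cus.
  have cdd := within_comp (@ddnegcost_continuous R) cus.
  pose f1 (y : R) := ddnegcost (u y s) * ux y s * G y s.
  pose f2 (y : R) := dnegcost (u y s) * ut y s.
  pose f3 (y : R) := negcost (u y s).
  have c1 : {within `[-1, 1], continuous f1}.
    by apply: within_mul => //; apply: within_mul => //; exact: contQ_slice.
  have c2 : {within `[-1, 1], continuous f2} by exact: contQ_slice cj1 s0.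
  have c3 : {within `[-1, 1], continuous f3} by exact: cj.
  pose F (y : R) := dnegcost (u y s) * G y s.
  have dF (y : R) : -1 < y < 1 -> is_derive y 1 F (f1 y + f2 y).
    move=> y1; apply: is_derive_fctM (dG y s y1 s0).
    by apply: is_derive_fct_comp (dux y s y1 s0); exact: is_derive_dnegcost.
  have := FTC _ (within_mul cd cGs) (within_add c1 c2) dF.
  have [-> ->] := G1 s s0; rewrite !mulr0 subrr => /(_ (ltW (ltN11 R))).
  rewrite (int_add c1 c2) => /eqP; rewrite addrC addr_eq0 => /eqP E.
  have : itg (-1) 1 (fun y => -1 * f1 y)
      <= itg (-1) 1 (fun y => 2 * C ^+ 2 * f3 y).
    apply: int_le.
    - by apply: within_mul => //; exact: within_cst.
    - by apply: within_mul => //; exact: within_cst.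
    - move=> y /andP[y1 y2]; have y1' : -1 <= y <= 1 by rewrite !ltW.
      rewrite mulN1r /f1 GE//; apply: le_trans (ddnegcost_drift _ _ _) _.
      rewrite ler_wpM2r ?negcost_ge0// ler_wpM2l// -real_normK ?num_real//.
      have WC : `|W y s| <= C by apply: HC => //; rewrite s0.
      by rewrite lerXn2r ?nnegrE// (le_trans _ WC).
  by rewrite (int_scale (-1) c1) (int_scale _ c3) mulN1r -E.
apply: negcost_eq0.
apply: (int_eq0_oo (f := fun y => negcost (u y T)) (cj T T0)) x1.
  by move=> y _; exact: negcost_ge0.
apply: (gronwall_from_zero _ dJ J'J J0 lim0 T0).
by rewrite mulr_ge0// sqr_ge0.
Qed.

(** * Boundary layer estimates for the steady state *)

Section steady_state_densities.
Context {R : realType} {m0 phi1 eps gam : R} {psi : R -> R}.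
Context (m0_gt0 : 0 < m0) (phi1_gt0 : 0 < phi1) (eps_gt0 : 0 < eps)
  (gam_gt0 : 0 < gam) (ss : steady_state m0 phi1 eps gam psi).
Implicit Types (x y : R).
Notation mu := (@lebesgue_measure R).
Local Notation n0 := (cations0 m0 psi).
Local Notation p0 := (anions0 m0 psi).
Local Notation dpsi := (dI psi).

Let N11 : -1 < 1 :> R := ltN11 R.
Let leN11 : -1 <= 1 :> R := ltW N11.

Lemma potential_continuous : {within `[-1, 1], continuous psi}.
Proof. by have [[]] := ss_C2 ss. Qed.

Lemma field_continuous : {within `[-1, 1], continuous dpsi}.
Proof. by have [[]] := ss_C2 ss. Qed.

Lemma is_derive_potential x : -1 < x < 1 -> is_derive x 1 psi (dpsi x).
Proof.
move=> x1; apply: is_derive_dI => //; have [[_ H _] _] := ss_C2 ss.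
by apply: H; rewrite in_itv/=; move: x1 => /andP[/ltW -> /ltW ->].
Qed.

Lemma is_derive_field x : -1 < x < 1 ->
  is_derive x 1 dpsi (delta0 m0 psi x / eps).
Proof.
move=> x1; have -> : delta0 m0 psi x / eps = dI dpsi x.
  by rewrite /delta0 -(ss_poisson ss x1) mulrAC mulfV ?mul1r// gt_eqF.
apply: is_derive_dI => //; have [_ [_ H _]] := ss_C2 ss.
by apply: H; rewrite in_itv/=; move: x1 => /andP[/ltW -> /ltW ->].
Qed.

Let cpsi := potential_continuous.
Let cdpsi := field_continuous.

Let cexp : {within `[-1, 1], continuous (fun x => expR (psi x))}.
Proof. by apply: within_comp cpsi; exact: continuous_expR. Qed.

Let cexpN : {within `[-1, 1], continuous (fun x => expR (- psi x))}.
Proof.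
by apply: (within_comp (k := expR)) (within_opp cpsi); exact: continuous_expR.
Qed.

Let int_gt0 (f : R -> R) : {within `[-1, 1], continuous f} ->
  (forall x, 0 < f x) -> 0 < itg (-1) 1 f.
Proof.
move=> cf f0; rewrite ltNge; apply/negP => If.
have : f 0 = 0 by apply: (int_eq0_oo cf) => // [x _|]; [exact: ltW|lra].
by move=> E; have := f0 0; rewrite E ltxx.
Qed.

Let A := m0 / itg (-1) 1 (fun x => expR (psi x)).
Let B := m0 / itg (-1) 1 (fun x => expR (- psi x)).

Let A_gt0 : 0 < A.
Proof. by rewrite divr_gt0// int_gt0// => x; exact: expR_gt0. Qed.

Let B_gt0 : 0 < B.
Proof. by rewrite divr_gt0// int_gt0// => x; exact: expR_gt0. Qed.

Let n0E x : n0 x = A * expR (psi x).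
Proof. by rewrite /cations0 /A mulrAC. Qed.

Let p0E x : p0 x = B * expR (- psi x).
Proof. by rewrite /anions0 /B mulrAC. Qed.

Lemma cations0_continuous : {within `[-1, 1], continuous n0}.
Proof.
rewrite (_ : n0 = fun x => A * expR (psi x)); last by apply/funext => x; exact: n0E.
by apply: within_mul cexp; exact: within_cst.
Qed.

Lemma anions0_continuous : {within `[-1, 1], continuous p0}.
Proof.
rewrite (_ : p0 = fun x => B * expR (- psi x)); last by apply/funext => x; exact: p0E.
by apply: within_mul cexpN; exact: within_cst.
Qed.

Lemma is_derive_cations0 x : -1 < x < 1 -> is_derive x 1 n0 (n0 x * dpsi x).
Proof.
move=> x1; rewrite (_ : n0 = fun x => A * expR (psi x)); last first.
  by apply/funext => y; exact: n0E.
rewrite -mulrA; apply: is_derive_fctZ; apply: is_derive_fct_exp.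
exact: is_derive_potential.
Qed.

Lemma is_derive_anions0 x : -1 < x < 1 -> is_derive x 1 p0 (- (p0 x * dpsi x)).
Proof.
move=> x1; rewrite (_ : p0 = fun x => B * expR (- psi x)); last first.
  by apply/funext => y; exact: p0E.
rewrite -mulrN -mulrA; apply: is_derive_fctZ.
apply: (is_derive_fct_exp (f := fun y => - psi y)); apply: is_derive_fctN.
exact: is_derive_potential.
Qed.

Lemma int_cations0 : itg (-1) 1 n0 = m0.
Proof.
rewrite (int_eq (g := fun x => A * expR (psi x))); last by move=> x _; exact: n0E.
rewrite (int_scale A cexp) /A mulfVK// gt_eqF// int_gt0// => x; exact: expR_gt0.
Qed.

Lemma int_anions0 : itg (-1) 1 p0 = m0.
Proof.
rewrite (int_eq (g := fun x => B * expR (- psi x))); last by move=> x _; exact: p0E.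
rewrite (int_scale B cexpN) /B mulfVK// gt_eqF// int_gt0// => x; exact: expR_gt0.
Qed.

Lemma delta0_continuous : {within `[-1, 1], continuous (delta0 m0 psi)}.
Proof. exact: within_sub cations0_continuous anions0_continuous. Qed.

Lemma eta0_continuous : {within `[-1, 1], continuous (eta0 m0 psi)}.
Proof. exact: within_add cations0_continuous anions0_continuous. Qed.

Lemma int_delta0 : itg (-1) 1 (delta0 m0 psi) = 0.
Proof.
by rewrite (int_sub cations0_continuous anions0_continuous) int_cations0 int_anions0 subrr.
Qed.

Lemma int_eta0 : itg (-1) 1 (eta0 m0 psi) = 2 * m0.
Proof.
by rewrite (int_add cations0_continuous anions0_continuous) int_cations0 int_anions0 mulr2n mulrDl mul1r.
Qed.

Lemma field_ends : dpsi (-1) = dpsi 1.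
Proof.
have := FTC leN11 cdpsi (within_mul delta0_continuous (within_cst _ eps^-1))
  is_derive_field.
rewrite (int_eq (g := fun x => eps^-1 * delta0 m0 psi x)); last by move=> *; exact: mulrC.
rewrite (int_scale eps^-1 delta0_continuous) int_delta0 mulr0 => /eqP.
by rewrite eq_sym subr_eq0 => /eqP.
Qed.

Lemma potential_ends : psi (-1) = - psi 1.
Proof.
have := ss_right ss; have := ss_left ss; rewrite field_ends => h1 h2; lra.
Qed.

(** Because the net charge vanishes, the potential may be shifted so that the
    two densities are [exp y] and [exp (- y)] up to a common factor; then the
    integrand below is nonnegative. *)
Lemma int_potential_charge_ge0 :
  0 <= itg (-1) 1 (fun x => psi x * delta0 m0 psi x).
Proof.
pose c := ln (B / A) / 2.
have BA : B = A * expR (c + c).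
  have BA0 : 0 < B / A := divr_gt0 B_gt0 A_gt0.
  rewrite /c -splitr (lnK BA0) mulrCA mulfV ?mulr1//.
  exact: lt0r_neq0.
have cq := delta0_continuous.
have -> : itg (-1) 1 (fun x => psi x * delta0 m0 psi x) =
    itg (-1) 1 (fun x => (psi x - c) * delta0 m0 psi x).
  rewrite [RHS](int_eq (g := fun x => psi x * delta0 m0 psi x - c * delta0 m0 psi x)).
    rewrite (int_sub (within_mul cpsi cq) (within_mul (within_cst _ c) cq)).
    by rewrite (int_scale c cq) int_delta0 mulr0 subr0.
  by move=> x _; rewrite mulrBl.
apply: int_ge0 => x _; rewrite /delta0 n0E p0E BA -mulrA -expRD -mulrBr.
rewrite mulrCA; apply: mulr_ge0; first exact: ltW.
have [cx|cx] := leP c (psi x).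
  by rewrite mulr_ge0 ?subr_ge0// ler_expR; lra.
by rewrite mulr_le0 ?subr_le0 ?ler_expR; lra.
Qed.

Let a := psi 1.
Let b := dpsi 1.

Let gamb : gam * b = phi1 - a.
Proof. by have := ss_right ss; rewrite -/a -/b => h; lra. Qed.

(** Testing the equation with [psi]: the charge term has a sign, so the work done
    at the walls bounds the field. *)
Let energy_identity : eps * itg (-1) 1 (fun x => dpsi x ^+ 2) <= 2 * eps * a * b.
Proof.
have cq := delta0_continuous.
have c1 := within_exp 2 cdpsi; have c2 := within_mul cpsi cq.
have dF (x : R) : -1 < x < 1 ->
    is_derive x 1 (fun y => psi y * dpsi y) (dpsi x ^+ 2 + eps^-1 * (psi x * delta0 m0 psi x)).
  move=> x1; have := is_derive_fctM (is_derive_potential x1) (is_derive_field x1).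
  by move/is_derive_eq; apply; rewrite expr2; ring.
have c3 := within_mul (within_cst _ eps^-1) c2.
have := FTC leN11 (within_mul cpsi cdpsi) (within_add c1 c3) dF.
rewrite (int_add c1 c3) (int_scale _ c2) potential_ends field_ends -/a -/b => E.
have I0 := int_potential_charge_ge0.
have : 0 <= eps^-1 * itg (-1) 1 (fun x => psi x * delta0 m0 psi x).
  by rewrite mulr_ge0// invr_ge0 ltW.
move=> h; rewrite [2 * _]mulrC -!mulrA ler_pM2l//; lra.
Qed.

(** Otherwise the field vanishes everywhere; then the wall potentials agree, being
    opposite they are 0, and the boundary condition reads [phi1 = 0]. *)
Let ab_gt0 : 0 < a * b.
Proof.
have c1 := within_exp 2 cdpsi.
have I0 : 0 <= itg (-1) 1 (fun x => dpsi x ^+ 2).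
  by apply: int_ge0 => x _; exact: sqr_ge0.
have := energy_identity; rewrite [2 * _]mulrC -!mulrA ler_pM2l// => E.
rewrite ltNge; apply/negP => ab0.
have d0 x : -1 < x < 1 -> dpsi x = 0.
  move=> x1; apply/eqP; rewrite -sqrf_eq0; apply/eqP.
  by apply: (int_eq0_oo c1) => //; [move=> y _; exact: sqr_ge0|lra].
have b0 : b = 0 by exact: within_eq0_right cdpsi d0.
have := FTC leN11 cpsi cdpsi is_derive_potential.
rewrite (int_eq_oo (g := fun=> 0)); [|exact: within_cst|exact: d0].
rewrite int_cst// mul0r potential_ends -/a => a0.
have {}a0 : a + a = 0 :> R by rewrite -{2}(opprK a) -a0.
have : phi1 = a by apply/eqP; rewrite -subr_eq0 -gamb b0 mulr0.
by have := phi1_gt0; lra.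
Qed.

Lemma potential_right_gt0 : 0 < a.
Proof.
have := ab_gt0; have := gamb => g1 ab; rewrite ltNge; apply/negP => a0.
have : 0 < gam * b by rewrite g1; have := phi1_gt0; lra.
rewrite pmulr_rgt0// => b0.
by move: ab; rewrite pmulr_lgt0// ltNge a0.
Qed.

Lemma field_right_gt0 : 0 < b.
Proof. by move: ab_gt0; rewrite pmulr_rgt0//; exact: potential_right_gt0. Qed.

Lemma potential_right_lt : a < phi1.
Proof. by rewrite -subr_gt0 -gamb; exact: mulr_gt0 gam_gt0 field_right_gt0. Qed.

Lemma first_integral x : -1 <= x <= 1 ->
  eps / 2 * dpsi x ^+ 2 - (n0 x + p0 x) = eps / 2 * dpsi 1 ^+ 2 - (n0 (-1) + p0 (-1)).
Proof.
move=> /andP[x1 x2].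
have sub : (`[-1, x] : set R) `<=` `[-1, 1] by apply: subset_itvl; rewrite bnd_simp.
have cF : {within `[-1, 1], continuous
    (fun y => eps / 2 * dpsi y ^+ 2 - (n0 y + p0 y))}.
  apply: within_sub; last exact: eta0_continuous.
  by apply: within_mul (within_exp 2 cdpsi); exact: within_cst.
have := FTC x1 (continuous_subspaceW sub cF) (within_cst _ 0).
rewrite int_cst// mul0r field_ends -/b => H.
apply/eqP; rewrite -subr_eq0; apply/eqP/esym/H => y /andP[y1 yx].
have y1' : -1 < y < 1 by rewrite y1 (lt_le_trans yx).
have := is_derive_fctB (is_derive_fctZ (eps / 2)
    (is_derive_fctX 1 (is_derive_field y1')))
  (is_derive_fctD (is_derive_cations0 y1') (is_derive_anions0 y1')).
move/is_derive_eq; apply; rewrite /delta0; field.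
by rewrite gt_eqF.
Qed.

(** Equal field strengths at the two walls force equal total concentrations
    there, which is only possible for the symmetric normalisation. *)
Lemma steady_state_symmetric : exists2 A : R, 0 < A &
  forall x, n0 x = A * expR (psi x) /\ p0 x = A * expR (- psi x).
Proof.
suff AB : A = B.
  exists A; first exact: A_gt0.
  by move=> x; split; [exact: n0E|rewrite AB; exact: p0E].
have := first_integral (x := 1); rewrite leN11 lexx => /(_ isT).
move=> /addrI/oppr_inj; rewrite !n0E !p0E potential_ends opprK -/a => E.
have : (A - B) * (expR a - expR (- a)) = 0 by lra.
move/eqP; rewrite mulf_eq0 !subr_eq0 => /orP[/eqP//|].
have : expR (- a) < expR a by rewrite ltr_expR; have := potential_right_gt0; lra.
by move=> /gt_eqF ->.
Qed.

End steady_state_densities.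

(** The layer estimates, for a potential that is only known through the first
    integral of its equation. *)
Section boundary_layer.
Context {R : realType} {m0 phi1 eps A : R} {psi dpsi : R -> R}.
Implicit Types (x y : R).
Let a := psi 1.
Let b := dpsi 1.
Let N11 : -1 < 1 :> R := ltN11 R.
Let leN11 : -1 <= 1 :> R := ltW N11.
Context (m0_gt0 : 0 < m0) (phi1_gt0 : 0 < phi1) (eps_gt0 : 0 < eps)
  (A_gt0 : 0 < A)
  (cpsi : {within `[-1, 1], continuous psi})
  (cdpsi : {within `[-1, 1], continuous dpsi})
  (is_derive_potential : forall x : R, -1 < x < 1 -> is_derive x 1 psi (dpsi x))
  (potential_ends : psi (-1) = - psi 1)
  (a_gt0 : 0 < a) (a_lt : a < phi1) (b_gt0 : 0 < b)
  (first_int : forall x : R, -1 <= x <= 1 ->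
    eps / 2 * dpsi x ^+ 2 - A * (expR (psi x) + expR (- psi x))
    = eps / 2 * b ^+ 2 - A * (expR (psi (-1)) + expR (- psi (-1))))
  (mass : itg (-1) 1 (fun x => A * (expR (psi x) + expR (- psi x))) = 2 * m0).

(** [S] and [cosh2] are twice the hyperbolic sine and cosine of half the
    potential. In these terms the first integral is
    [dpsi ^+ 2 = C + K * S ^+ 2]. *)
Let S x := expR (psi x / 2) - expR (- (psi x / 2)).
Let K := A / eps * 2.
Let C := b ^+ 2 - K * S 1 ^+ 2.

Let K_gt0 : 0 < K.
Proof. by rewrite mulr_gt0// divr_gt0. Qed.

Let eS x : expR (psi x) + expR (- psi x) = S x ^+ 2 + 2.
Proof.
have -> : expR (psi x) = expR (psi x / 2) ^+ 2 by rewrite expr2 -expRD -splitr.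
have -> : expR (- psi x) = expR (- (psi x / 2)) ^+ 2.
  by rewrite expr2 -expRD -opprD -splitr.
have : expR (psi x / 2) * expR (- (psi x / 2)) = 1 by rewrite -expRD subrr expR0.
by rewrite /S => E; ring: E.
Qed.

Let SN1 : S (-1) = - S 1.
Proof. by rewrite /S potential_ends mulNr opprK opprB. Qed.

Let S1_gt0 : 0 < S 1.
Proof. by rewrite /S subr_gt0 ltr_expR -/a; have := a_gt0; lra. Qed.

Let field_sqr x : -1 <= x <= 1 -> dpsi x ^+ 2 = C + K * S x ^+ 2.
Proof.
move=> /first_int; rewrite !eS SN1 sqrrN => E.
apply: (mulfI (_ : eps / 2 != 0)); first by rewrite gt_eqF// divr_gt0.
move/eqP: E; rewrite subr_eq => /eqP ->; rewrite /C /K; field.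
by rewrite gt_eqF.
Qed.

Let zero_potential : exists2 z, -1 <= z <= 1 & psi z = 0.
Proof.
have := @IVT _ psi (-1) 1 0 leN11 cpsi; rewrite potential_ends -/a.
have a0 := ltW a_gt0; rewrite ge_min le_max oppr_le0 a0 !orbT.
by move=> /(_ isT)[z]; rewrite in_itv/= => ? ?; exists z.
Qed.

Let S0 x : psi x = 0 -> S x = 0.
Proof. by rewrite /S => ->; rewrite mul0r oppr0 subrr. Qed.

Let cosh2 x := expR (psi x / 2) + expR (- (psi x / 2)).

Let is_derive_half x : -1 < x < 1 -> is_derive x 1 (fun y => psi y / 2) (dpsi x / 2).
Proof.
move=> /is_derive_potential dp; have := is_derive_fctZ 2^-1 dp.
by under eq_fun do rewrite mulrC; rewrite mulrC.
Qed.

Let is_derive_S x : -1 < x < 1 -> is_derive x 1 S (dpsi x / 2 * cosh2 x).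
Proof.
move=> x1; have d := is_derive_half x1.
have := is_derive_fctB (is_derive_fct_exp d) (is_derive_fct_exp (is_derive_fctN d)).
by move/is_derive_eq; apply; rewrite /cosh2; ring.
Qed.

Let is_derive_cosh2 x : -1 < x < 1 -> is_derive x 1 cosh2 (dpsi x / 2 * S x).
Proof.
move=> x1; have d := is_derive_half x1.
have := is_derive_fctD (is_derive_fct_exp d) (is_derive_fct_exp (is_derive_fctN d)).
by move/is_derive_eq; apply; rewrite /S; ring.
Qed.

Let chalf : {within `[-1, 1], continuous (fun x => psi x / 2)}.
Proof. exact: within_mul cpsi (within_cst _ 2^-1). Qed.

Let ce1 : {within `[-1, 1], continuous (fun x => expR (psi x / 2))}.
Proof. by apply: (within_comp (k := expR)) chalf; exact: continuous_expR. Qed.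

Let ce2 : {within `[-1, 1], continuous (fun x => expR (- (psi x / 2)))}.
Proof.
by apply: (within_comp (k := expR)) (within_opp chalf); exact: continuous_expR.
Qed.

Let cS : {within `[-1, 1], continuous S}.
Proof. exact: within_sub ce1 ce2. Qed.

Let ccosh2 : {within `[-1, 1], continuous cosh2}.
Proof. exact: within_add ce1 ce2. Qed.

Let C_ge0 : 0 <= C.
Proof.
have [z z1 pz] := zero_potential.
by have := field_sqr z1; rewrite (S0 pz) expr0n/= mulr0 addr0 => <-; exact: sqr_ge0.
Qed.

(** If the field vanished where the potential does, uniqueness for the first
    order equation [dpsi ^+ 2 = K * S ^+ 2] would make the potential zero. *)
Let C_gt0 : 0 < C.
Proof.
rewrite lt_neqAle C_ge0 andbT eq_sym; apply/negP => /eqP C0.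
have [z z1 pz] := zero_potential; have /andP[z2 z3] := z1.
have [E E0 HE] := within_bounded ccosh2.
pose L := (1 + K) * E.
have sub : (`[z, 1] : set R) `<=` `[-1, 1] by apply: subset_itvr; rewrite bnd_simp.
have cL : {within `[-1, 1], continuous (fun x => expR (- L * x) * S x ^+ 2)}.
  apply: within_mul (within_exp 2 cS).
  by apply: continuous_subspaceT => x; apply: (is_derive_continuous
    (is_derive_fct_exp (is_derive_fctZ (- L) (is_derive_id x 1)))).
have := nonincreasing_of_derive z3 (continuous_subspaceW sub cL).
pose df x := expR (- L * x) * - L * S x ^+ 2
  + expR (- L * x) * (2 * S x ^+ 1 * (dpsi x / 2 * cosh2 x)).
move=> /(_ df) H; have {}H : expR (- L * 1) * S 1 ^+ 2 <= expR (- L * z) * S z ^+ 2.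
  apply: H => x /andP[zx x1]; have xN1 : -1 < x < 1 by rewrite (le_lt_trans z2 zx).
    have := is_derive_fctM (is_derive_fct_exp (is_derive_fctZ (- L) (is_derive_id x 1)))
      (is_derive_fctX 1 (is_derive_S xN1)).
    by move/is_derive_eq; apply; rewrite /df mulr1.
  rewrite /df -mulrA -mulrDr pmulr_rle0 ?expR_gt0//.
  have x1' : -1 <= x <= 1 by case/andP: xN1 => /ltW -> /ltW ->.
  have := HE x x1'; rewrite ler_norml => /andP[h1 h2].
  have := field_sqr x1'; rewrite C0 add0r => h3.
  have h4 : 0 <= (S x - dpsi x) ^+ 2 by exact: sqr_ge0.
  have h5 : 0 <= (S x + dpsi x) ^+ 2 by exact: sqr_ge0.
  have h6 : S x * dpsi x <= (1 + K) * S x ^+ 2 by nra.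
  have h7 : - (S x * dpsi x) <= (1 + K) * S x ^+ 2 by nra.
  have h8 : 0 <= (1 + K) * S x ^+ 2.
    by apply: mulr_ge0 (sqr_ge0 _); apply: addr_ge0 (ltW K_gt0).
  have h9 : 0 < cosh2 x by rewrite addr_gt0 ?expR_gt0.
  have h10 : S x * dpsi x * cosh2 x <= (1 + K) * S x ^+ 2 * E.
    apply: (@le_trans _ _ ((1 + K) * S x ^+ 2 * cosh2 x)).
      by rewrite ler_wpM2r// ltW.
    by rewrite ler_wpM2l.
  rewrite /L expr1; lra.
move: H; rewrite (S0 pz) expr0n/= mulr0 pmulr_rle0 ?expR_gt0//.
by rewrite leNgt exprn_gt0// S1_gt0.
Qed.

Let field_gt0 x : -1 <= x <= 1 -> 0 < dpsi x.
Proof.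
move=> x1; rewrite ltNge; apply/negP => dx.
have /andP[x2 x3] := x1.
have sub : (`[x, 1] : set R) `<=` `[-1, 1] by apply: subset_itvr; rewrite bnd_simp.
have := @IVT _ dpsi x 1 0 x3 (continuous_subspaceW sub cdpsi).
rewrite -/b; have b0 := b_gt0.
rewrite ge_min le_max dx (ltW b0) !orbT.
move=> /(_ isT)[z]; rewrite in_itv/= => /andP[z1 z2] dz.
have := field_sqr (x := z); rewrite dz z2 (le_trans x2 z1) => /(_ isT).
rewrite expr0n/= => E; have := C_gt0.
have : 0 <= K * S z ^+ 2 by exact: mulr_ge0 (ltW K_gt0) (sqr_ge0 _).
lra.
Qed.

Let psi_ndecr x y : -1 <= x -> x <= y -> y <= 1 -> psi x <= psi y.
Proof.
move=> x1 xy y1; rewrite -lerN2.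
apply: (@nonincreasing_of_derive _ (fun z => - psi z) (fun z => - dpsi z)) => //.
- apply: within_opp; apply: continuous_subspaceW cpsi.
  by apply: subset_itvScc; rewrite bnd_simp.
- move=> z /andP[z1 z2]; apply: is_derive_fctN; apply: is_derive_potential.
  by rewrite (le_lt_trans x1 z1) (lt_le_trans z2).
- move=> z /andP[z1 z2]; rewrite oppr_le0 ltW//; apply: field_gt0.
  by rewrite (le_trans x1 (ltW z1)) (le_trans (ltW z2)).
Qed.

Let T := cosh2 1 - 2.
Let q := Num.sqrt K.

Let q_gt0 : 0 < q. Proof. by rewrite sqrtr_gt0. Qed.

(** The integrand is the derivative of a function of the potential, so the result
    depends on the wall potential and not on the width of the layer. *)
Let int_Sfield : itg (-1) 1 (fun x => `|S x| * dpsi x) = 4 * T.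
Proof.
have [z z1 pz] := zero_potential; have /andP[z2 z3] := z1.
have cz : cosh2 z = 2 by rewrite /cosh2 pz mul0r oppr0 expR0.
have cN1 : cosh2 (-1) = cosh2 1.
  by rewrite /cosh2 potential_ends mulNr opprK addrC.
have subr : (`[z, 1] : set R) `<=` `[-1, 1] by apply: subset_itvr; rewrite bnd_simp.
have subl : (`[-1, z] : set R) `<=` `[-1, 1] by apply: subset_itvl; rewrite bnd_simp.
have cF := within_mul (within_cst _ 2) ccosh2.
have cf := within_mul cS cdpsi.
have dF x : -1 < x < 1 -> is_derive x 1 (fun y => 2 * cosh2 y) (S x * dpsi x).
  move=> /is_derive_cosh2 d; have := is_derive_fctZ 2 d.
  by move/is_derive_eq; apply; field.
rewrite (int_chasles z1 (within_mul (within_norm cS) cdpsi)).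
have -> : itg z 1 (fun x => `|S x| * dpsi x) = itg z 1 (fun x => S x * dpsi x).
  apply: int_eq => x /andP[zx x1]; rewrite ger0_norm// /S subr_ge0 ler_expR.
  have := psi_ndecr z2 zx x1; rewrite pz; lra.
have -> : itg (-1) z (fun x => `|S x| * dpsi x) = itg (-1) z (fun x => -1 * (S x * dpsi x)).
  apply: int_eq => x /andP[x1 xz]; rewrite ler0_norm ?mulN1r ?mulNr//.
  rewrite /S subr_le0 ler_expR; have := psi_ndecr x1 xz z3; rewrite pz; lra.
rewrite (int_scale _ (continuous_subspaceW subl cf)).
have dr x : z < x < 1 -> is_derive x 1 (fun y => 2 * cosh2 y) (S x * dpsi x).
  by move=> /andP[zx x1]; apply: dF; rewrite (le_lt_trans z2 zx).
have dl x : -1 < x < z -> is_derive x 1 (fun y => 2 * cosh2 y) (S x * dpsi x).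
  by move=> /andP[x1 xz]; apply: dF; rewrite x1 (lt_le_trans xz).
rewrite (FTC z3 (continuous_subspaceW subr cF) (continuous_subspaceW subr cf) dr).
rewrite (FTC z2 (continuous_subspaceW subl cF) (continuous_subspaceW subl cf) dl).
rewrite cz cN1 /T; lra.
Qed.

Let field_ge x : -1 <= x <= 1 -> q * `|S x| <= dpsi x.
Proof.
move=> x1; have d0 := field_gt0 x1.
apply: le_of_sqr; first exact: ltW.
rewrite exprMn real_normK ?num_real// sqr_sqrtr; last exact: ltW.
by rewrite field_sqr// lerDr.
Qed.

Let field_le x : -1 <= x <= 1 -> dpsi x <= q * `|S x| + Num.sqrt C.
Proof.
move=> x1; have d0 := field_gt0 x1.
have s0 : 0 <= q * `|S x| := mulr_ge0 (ltW q_gt0) (normr_ge0 _).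
have h0 : 0 <= q * `|S x| * Num.sqrt C := mulr_ge0 s0 (sqrtr_ge0 C).
apply: le_of_sqr; first exact: addr_ge0 s0 (sqrtr_ge0 C).
rewrite field_sqr// [(_ + Num.sqrt C) ^+ 2]sqrrD [(q * _) ^+ 2]exprMn.
rewrite real_normK ?num_real// sqr_sqrtr; last exact: ltW.
rewrite sqr_sqrtr//; lra.
Qed.

Let int_field : itg (-1) 1 dpsi = 2 * a.
Proof.
rewrite (FTC leN11 cpsi cdpsi is_derive_potential) potential_ends -/a.
by rewrite opprK mulr2n mulrDl !mul1r.
Qed.

Let C_le : Num.sqrt C <= a.
Proof.
have : itg (-1) 1 (fun=> Num.sqrt C) <= itg (-1) 1 dpsi.
  apply: int_le cdpsi _; first exact: within_cst.
  move=> x /andP[x1 x2]; have x1' : -1 <= x <= 1 by rewrite !ltW.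
  apply: le_of_sqr; first exact/ltW/field_gt0.
  rewrite sqr_sqrtr// field_sqr// lerDl.
  exact: mulr_ge0 (ltW K_gt0) (sqr_ge0 _).
rewrite int_cst// int_field; lra.
Qed.

Let T_le : T <= (expR phi1 - 1) / 2.
Proof.
have r1 : 1 <= expR (a / 2) by rewrite -expR0 ler_expR divr_ge0// ltW.
have : expR a <= expR phi1 by rewrite ler_expR ltW.
have -> : expR a = expR (a / 2) ^+ 2 by rewrite expr2 -expRD -splitr.
have : expR (a / 2) * expR (- (a / 2)) = 1 by rewrite -expRD subrr expR0.
have : 0 < expR (- (a / 2)) by rewrite expR_gt0.
rewrite /T /cosh2 -/a.
set r := expR (a / 2) in r1 *; set s := expR (- (a / 2)) => s0 rs rp.
have s1 : s <= 1 by rewrite -(ler_pM2l (_ : 0 < r)) ?rs ?mulr1//; lra.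
nra.
Qed.

Let T_ge0 : 0 <= T.
Proof.
have : 0 <= 4 * T.
  rewrite -int_Sfield; apply: int_ge0 => x x1.
  by rewrite mulr_ge0// ltW// field_gt0.
lra.
Qed.

Let q_int_S2 : q * itg (-1) 1 (fun x => S x ^+ 2) <= 4 * T.
Proof.
rewrite -int_Sfield -(int_scale q (within_exp 2 cS)).
apply: int_le.
- by apply: within_mul (within_exp 2 cS); exact: within_cst.
- by apply: within_mul cdpsi; exact: within_norm cS.
move=> x /andP[x1 x2]; have x1' : -1 <= x <= 1 by rewrite !ltW.
rewrite -real_normK ?num_real// expr2 mulrCA ler_wpM2l//.
exact: field_ge.
Qed.

Let deficit : m0 - 2 * A = A / 2 * itg (-1) 1 (fun x => S x ^+ 2).
Proof.
have := mass; rewrite (int_eq (g := fun x => A * (S x ^+ 2 + 2))); last first.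
  by move=> x _; rewrite eS.
have cS2 := within_exp 2 cS.
rewrite (int_scale A (within_add cS2 (within_cst _ 2))) (int_add cS2 (within_cst _ 2)).
rewrite int_cst// => E; lra.
Qed.

Let deficit_ge0 : 2 * A <= m0.
Proof.
rewrite -subr_ge0 deficit mulr_ge0//; first by rewrite divr_ge0// ltW.
by apply: int_ge0 => x _; exact: sqr_ge0.
Qed.

(** [q] is an inverse layer width; [2 * A <= m0] bounds it from above by an
    explicit power of [eps]. *)
Let eps_q : eps * q <= Num.sqrt (m0 * eps).
Proof.
apply: le_of_sqr; first exact: sqrtr_ge0.
rewrite exprMn sqr_sqrtr; last exact: ltW.
rewrite sqr_sqrtr; last by apply: mulr_ge0; exact: ltW.
rewrite (_ : eps ^+ 2 * K = 2 * A * eps); last first.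
  by rewrite /K; field; rewrite gt_eqF.
by rewrite ler_wpM2r// ltW.
Qed.

Let deficit_le : m0 - 2 * A <= eps * q * T.
Proof.
rewrite -(ler_pM2l q_gt0) deficit mulrCA.
have -> : q * (eps * q * T) = A / 2 * (4 * T).
  rewrite (_ : q * _ = eps * q ^+ 2 * T); last by ring.
  by rewrite sqr_sqrtr ?ltW// /K; field; rewrite gt_eqF.
by rewrite ler_wpM2l ?q_int_S2// divr_ge0// ltW.
Qed.

Let kap_bound : eps * q * T <= Num.sqrt (m0 * eps) * (expR phi1 - 1) / 2.
Proof.
rewrite -[leRHS]mulrA; apply: ler_pM => //.
exact: mulr_ge0 (ltW eps_gt0) (ltW q_gt0).
Qed.

(** The total concentration exceeds its minimum [2 * A] by [A * S ^+ 2]; as its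
    mean is [m0], the deficit is controlled by the boundary layer. *)
Lemma layer_lower x : m0 - Num.sqrt (m0 * eps) * (expR phi1 - 1) / 2
  <= A * (expR (psi x) + expR (- psi x)).
Proof.
rewrite eS; have := deficit_le; have := kap_bound.
have : 0 <= A * S x ^+ 2 := mulr_ge0 (ltW A_gt0) (sqr_ge0 _).
rewrite mulrDr => ? ? ?; lra.
Qed.

Lemma layer_field_energy : 4 * eps * phi1 ^+ 2 <= m0 ->
  eps * itg (-1) 1 (fun x => dpsi x ^+ 2)
  <= 3 * (Num.sqrt (m0 * eps) * (expR phi1 - 1)).
Proof.
move=> small.
have c1 := within_mul (within_norm cS) cdpsi.
have c2 := within_mul (within_cst _ q) c1.
have c3 := within_mul (within_cst _ (Num.sqrt C)) cdpsi.
have : itg (-1) 1 (fun x => dpsi x ^+ 2)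
    <= itg (-1) 1 (fun x => q * (`|S x| * dpsi x) + Num.sqrt C * dpsi x).
  apply: (int_le (within_exp 2 cdpsi) (within_add c2 c3)).
  move=> x /andP[x1 x2]; have x1' : -1 <= x <= 1 by rewrite !ltW.
  rewrite mulrA -mulrDl expr2 ler_wpM2r ?field_le//.
  exact/ltW/field_gt0.
rewrite (int_add c2 c3) (int_scale q c1) (int_scale _ cdpsi) int_Sfield int_field.
rewrite -(ler_pM2l eps_gt0) => /le_trans; apply.
have h1 := kap_bound; have h2 := C_le; have a0 := a_gt0; have a1 := a_lt.
have s0 : 0 <= Num.sqrt C by rewrite sqrtr_ge0.
have h3 : Num.sqrt C * a <= phi1 ^+ 2.
  by rewrite expr2; apply: ler_pM => //; [exact: ltW|exact: le_trans h2 (ltW a1)|exact: ltW].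
have h4 : 0 <= Num.sqrt (m0 * eps) by rewrite sqrtr_ge0.
have h5 : phi1 <= expR phi1 - 1 by have := expR_ge1Dx phi1; lra.
have h6 : 2 * eps * phi1 <= Num.sqrt (m0 * eps).
  apply: le_of_sqr => //.
  rewrite sqr_sqrtr; last by apply: mulr_ge0; exact: ltW.
  rewrite (_ : (2 * eps * phi1) ^+ 2 = 4 * eps * phi1 ^+ 2 * eps); last by ring.
  by rewrite ler_wpM2r// ltW.
have e0 := ltW eps_gt0.
have h7 : eps * (Num.sqrt C * (2 * a)) <= 2 * eps * phi1 * phi1.
  rewrite (_ : 2 * eps * phi1 * phi1 = eps * (2 * phi1 ^+ 2)); last by ring.
  rewrite (_ : Num.sqrt C * (2 * a) = 2 * (Num.sqrt C * a)); last by ring.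
  by apply: ler_wpM2l => //; apply: ler_wpM2l.
have h8 : 2 * eps * phi1 * phi1 <= Num.sqrt (m0 * eps) * (expR phi1 - 1).
  have p0' := ltW phi1_gt0.
  by apply: ler_pM => //; apply: mulr_ge0 => //; apply: mulr_ge0.
rewrite (_ : eps * _ = 4 * (eps * q * T) + eps * (Num.sqrt C * (2 * a))); last by ring.
move: h1 h7 h8; set u := eps * q * T; set v := eps * _; set w := Num.sqrt _ * _.
by move=> *; lra.
Qed.

End boundary_layer.

Section steady_state_estimates.
Context {R : realType} {m0 phi1 eps gam : R} {psi : R -> R}.
Context (m0_gt0 : 0 < m0) (phi1_gt0 : 0 < phi1) (eps_gt0 : 0 < eps)
  (gam_gt0 : 0 < gam) (ss : steady_state m0 phi1 eps gam psi).
Implicit Types (x : R).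

Let layer (Q : Prop) :
  (forall A : R, 0 < A ->
    (forall x, eta0 m0 psi x = A * (expR (psi x) + expR (- psi x))) ->
    (forall x, -1 <= x <= 1 ->
      eps / 2 * dI psi x ^+ 2 - A * (expR (psi x) + expR (- psi x))
      = eps / 2 * dI psi 1 ^+ 2 - A * (expR (psi (-1)) + expR (- psi (-1)))) ->
    itg (-1) 1 (fun x => A * (expR (psi x) + expR (- psi x))) = 2 * m0 -> Q) -> Q.
Proof.
have [A A0 AE] := steady_state_symmetric m0_gt0 phi1_gt0 eps_gt0 gam_gt0 ss.
have etaE x : eta0 m0 psi x = A * (expR (psi x) + expR (- psi x)).
  by have [nE pE] := AE x; rewrite /eta0 nE pE mulrDr.
move=> /(_ A A0 etaE); apply.
  by move=> x x1; rewrite -!etaE; exact: first_integral eps_gt0 ss x x1.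
by rewrite -(int_eta0 ss); apply: int_eq => x _; rewrite etaE.
Qed.

Let layer_facts :=
  (potential_right_gt0 m0_gt0 phi1_gt0 eps_gt0 gam_gt0 ss,
   potential_right_lt m0_gt0 phi1_gt0 eps_gt0 gam_gt0 ss,
   field_right_gt0 m0_gt0 phi1_gt0 eps_gt0 gam_gt0 ss).

Lemma eta0_lower x :
  m0 - Num.sqrt (m0 * eps) * (expR phi1 - 1) / 2 <= eta0 m0 psi x.
Proof.
have [[a0 a1] b0] := layer_facts.
apply: layer => A A0 etaE fi mass; rewrite etaE.
exact (layer_lower m0_gt0 eps_gt0 A0 (potential_continuous ss)
  (field_continuous ss) (is_derive_potential ss) (potential_ends eps_gt0 ss)
  a0 a1 b0 fi mass x).
Qed.

Lemma field_energy : 4 * eps * phi1 ^+ 2 <= m0 ->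
  eps * itg (-1) 1 (fun x => dI psi x ^+ 2)
  <= 3 * (Num.sqrt (m0 * eps) * (expR phi1 - 1)).
Proof.
have [[a0 a1] b0] := layer_facts.
apply: layer => A A0 etaE fi mass.
exact (layer_field_energy m0_gt0 phi1_gt0 eps_gt0 A0 (potential_continuous ss)
  (field_continuous ss) (is_derive_potential ss) (potential_ends eps_gt0 ss)
  a0 a1 b0 fi mass).
Qed.

End steady_state_estimates.

(** * Primitives of conserved quantities *)

Section regularity.
Context {R : realType}.
Implicit Types (u : R -> R -> R) (x t : R).

Let oo_cc x : -1 < x < 1 -> -1 <= x <= 1.
Proof. by move=> /andP[/ltW -> /ltW ->]. Qed.

Lemma C1x_is_derive u x t : C1x u -> -1 < x < 1 -> 0 < t ->
  is_derive x 1 (u ^~ t) (dx u x t).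
Proof.
move=> [_ du _] x1 t0; apply: (is_derive_dI (f := u ^~ t)) => //.
by apply: du => //; exact: oo_cc.
Qed.

Lemma C1t_is_derive u x t : C1t u -> -1 <= x <= 1 -> 0 < t ->
  is_derive t 1 (u x) (dt u x t).
Proof.
move=> [du _] x1 t0; have d := du x t x1 t0.
by split => //; rewrite /dt derive1E.
Qed.

Lemma dx_is_derive u x t l : -1 < x < 1 ->
  is_derive x 1 (u ^~ t) l -> dx u x t = l.
Proof. by move=> x1; exact: dI_is_derive. Qed.

Lemma constant_of_derive0 (f : R -> R) : (forall t, 0 < t -> is_derive t 1 f 0) ->
  forall s t, 0 < s -> s <= t -> f s = f t.
Proof.
move=> df s t s0 st.
have ds z : s <= z <= t -> is_derive z 1 f 0.
  by move=> /andP[sz _]; apply: df; exact: lt_le_trans sz.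
have dsN z : s <= z <= t -> is_derive z 1 (fun y => - f y) (- 0).
  by move=> /ds; exact: is_derive_fctN.
have oc z : s < z < t -> s <= z <= t by move=> /andP[/ltW -> /ltW ->].
apply/eqP; rewrite eq_le; apply/andP; split; last first.
  apply: (nonincreasing_of_derive st (is_derive_within ds)) => [z /oc|z _].
    exact: ds.
  by [].
rewrite -lerN2.
apply: (nonincreasing_of_derive st (is_derive_within dsN)) => [z /oc|z _].
  exact: dsN.
by rewrite oppr0.
Qed.

End regularity.

(** One conservation law with vanishing boundary flux, seen through the
    primitive of the conserved quantity; both equations of the perturbed system
    have this shape, with the two unknowns exchanged. *)
Section conserved_flux.
Context {R : realType} (u w phi : R -> R -> R) (A A' P P' : R -> R).
Implicit Types (x y t s : R).
Context (ux : C2x u) (ut : C1t u) (wx : C2x w) (phix : C2x phi)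
  (cA : {within `[-1, 1], continuous A})
  (cP : {within `[-1, 1], continuous P})
  (dA : forall x : R, -1 < x < 1 -> is_derive x 1 A (A' x))
  (dP : forall x : R, -1 < x < 1 -> is_derive x 1 P (P' x)).

Let F x t := dx u x t - A x * dx phi x t - w x t * P x - w x t * dx phi x t.

Context (equation : forall x t : R, -1 < x < 1 -> 0 < t ->
    dt u x t = dx (dx u) x t
      - dx (fun y s => A y * dx phi y s) x t
      - dx (fun y s => w y s * P y) x t
      - dx (fun y s => w y s * dx phi y s) x t)
  (no_flux : forall t : R, 0 < t -> F (-1) t = 0 /\ F 1 t = 0).

Let cu : contQ u. Proof. by case: ux => -[]. Qed.

Lemma contQ_flux : contQ F.
Proof.
have cux : contQ (dx u) by case: ux => -[].
have cw : contQ w by case: wx => -[].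
have cphi : contQ (dx phi) by case: phix => -[].
exact: within_sub (within_sub (within_sub cux (within_mul (contQ_space cA) cphi))
  (within_mul cw (contQ_space cP))) (within_mul cw cphi).
Qed.

Lemma is_derive_flux x t : -1 < x < 1 -> 0 < t ->
  is_derive x 1 (F ^~ t) (dt u x t).
Proof.
move=> x1 t0; rewrite equation//.
have dphi := C1x_is_derive phix.2 x1 t0.
have dw := C1x_is_derive wx.1 x1 t0.
have d1 := is_derive_fctM (dA x1) dphi.
have d2 := is_derive_fctM dw (dP x1).
have d3 := is_derive_fctM dw dphi.
rewrite (dx_is_derive (u := fun y s => A y * dx phi y s) x1 d1).
rewrite (dx_is_derive (u := fun y s => w y s * P y) x1 d2).
rewrite (dx_is_derive (u := fun y s => w y s * dx phi y s) x1 d3).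
exact: is_derive_fctB (is_derive_fctB (is_derive_fctB (C1x_is_derive ux.2 x1 t0) d1) d2) d3.
Qed.

Let U x t := itg (-1) x (u ^~ t).

Lemma primitive_slice t : 0 < t -> {within `[-1, 1], continuous (U ^~ t)}.
Proof. by move=> t0; apply: within_primitive (ltW (ltN11 R)) (contQ_slice cu t0). Qed.

Lemma is_derive_primitive_slice x t : -1 < x < 1 -> 0 < t ->
  is_derive x 1 (U ^~ t) (u x t).
Proof. by move=> x1 t0; apply: is_derive_primitive (contQ_slice cu t0) x1. Qed.

Lemma locally_boundedQ_primitive : locally_boundedQ U.
Proof.
move=> a b a0; have [C HC] := contQ_bounded cu b a0.
exists (2 * `|C|) => x t /andP[x1 x2] /[dup] tab /andP[ta tb].
have t0 := lt_le_trans a0 ta.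
have cut := contQ_slice cu t0.
have sub : (`[-1, x] : set R) `<=` `[-1, 1] by apply: subset_itvl; rewrite bnd_simp.
have cux := continuous_subspaceW sub cut.
apply: le_trans (le_normr_Rintegral _ _) _ => //.
  exact: integrable_within.
rewrite -[leLHS]/(itg (-1) x (fun y => `|u y t|)).
have : itg (-1) x (fun y => `|u y t|) <= itg (-1) x (fun=> `|C|).
  apply: int_le (within_norm cux) (within_cst _ _) _ => y /andP[y1 yx].
  apply: le_trans (ler_norm C); apply: HC => //.
  by rewrite (ltW y1) (ltW (lt_le_trans yx x2)).
rewrite int_cst// => /le_trans; apply.
by rewrite mulrC ler_wpM2r//; lra.
Qed.

Lemma is_derive_primitive_time x t : -1 <= x <= 1 -> 0 < t ->
  is_derive t 1 (U x) (F x t).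
Proof.
move=> /andP[x1 x2] t0.
have cdt := contQ_slice ut.2 t0.
have sub : (`[-1, x] : set R) `<=` `[-1, 1] by apply: subset_itvl; rewrite bnd_simp.
have dF y : -1 < y < x -> is_derive y 1 (F ^~ t) (dt u y t).
  by move=> /andP[y1 yx]; apply: is_derive_flux t0; rewrite y1 (lt_le_trans yx).
have := FTC x1 (continuous_subspaceW sub (contQ_slice contQ_flux t0))
  (continuous_subspaceW sub cdt) dF.
have [-> _] := no_flux t0; rewrite subr0 => <-.
apply: (is_derive_int (u := u) (ut := dt u)) => //.
- by move=> s s0; exact: contQ_slice.
- by move=> y s y1 s0; exact: C1t_is_derive.
- exact: contQ_bounded ut.2.
Qed.

Lemma primitive_left t : U (-1) t = 0.
Proof. by rewrite /U /itg set_itv1 Rintegral_set1. Qed.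

(** Mass is conserved for positive times; its value is carried over from the
    initial time by convergence in [L^2]. *)
Lemma primitive_right t : sq_integrable (u ^~ 0) ->
  L2norm (fun x => u x t - u x 0) @[t --> 0^'+] --> 0%E ->
  itg (-1) 1 (u ^~ 0) = 0 -> 0 < t -> U 1 t = 0.
Proof.
move=> u0 lim mass0 t0.
have cus s : 0 < s -> {within `[-1, 1], continuous (u ^~ s)} by exact: contQ_slice.
have dU s : 0 < s -> is_derive s 1 (U 1) 0.
  move=> s0; have [_ <-] := no_flux s0.
  by apply: is_derive_primitive_time; rewrite // lexx (ltW (ltN11 R)).
apply/eqP; rewrite -normr_le0; apply/ler_addgt0Pr => e e0; rewrite add0r.
have H := L2_cvg_norm cus u0 lim e0.
have : \forall s \near 0^'+,
    [/\ 0 < s, s < t & itg (-1) 1 (fun x => `|u x s - u x 0|) < e].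
  near=> s; split; near: s; [exact: nbhs_right_gt|exact: nbhs_right_lt|exact: H].
move=> /filter_ex[s [s0 st Hs]].
rewrite -(constant_of_derive0 dU s0 (ltW st)).
have := @primitive_dist _ (u ^~ s) (u ^~ 0) 1 _ (integrable_within (cus s s0))
  (sq_integrable_integrable u0).
rewrite lexx (ltW (ltN11 R)) mass0 subr0 => /(_ isT) /le_trans; apply.
exact: ltW.
Unshelve. all: by end_near. Qed.

End conserved_flux.

(** * Algebra and constants of the dissipation inequality *)

(** The difference of the two sides is the sum of the five nonnegative
    quantities in the proof; the squares among them are three uses of Young's
    inequality. Here [e0 + h] is the total concentration [n + p], [e0 - m0 + k]
    the excess of the steady concentration over its lower bound, and the terms
    linear in [B] and [h] have vanishing mean. *)
Lemma dissipation_pointwise (R : realFieldType)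
    (eps m0 m' k s d de h B e0 px : R) :
  0 < eps -> 0 < m0 -> 0 <= e0 + h -> 0 <= e0 - m0 + k -> 0 <= k ->
  m' <= m0 - 4 * k ->
  (- de ^+ 2 - h ^+ 2 - e0 * ((B + s * d) / eps) * (B + d)
   - (B + d) ^+ 2 * h / (2 * eps) - (1 - s) * d * px * h)
  + (de ^+ 2 + (2^-1 - d ^+ 2 / (m0 * eps)) * h ^+ 2)
  + (4 * eps)^-1 * m' * B ^+ 2
  <= (- ((1 + s) * d * (m0 - k) / eps)) * B + (- (d ^+ 2 / (2 * eps))) * h
     + d ^+ 2 / eps * (eps / 2 * (1 - s) ^+ 2 * px ^+ 2
                       + 2^-1 * (1 + s) ^+ 2 * (e0 - m0 + k) - s * e0).
Proof.
move=> eps0 m00 N0 w0 k0 m'le; rewrite -subr_ge0.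
have e2 : 0 <= (2 * eps)^-1 by rewrite invr_ge0 mulr_ge0// ltW.
have e4 : 0 <= (4 * eps)^-1 by rewrite invr_ge0 mulr_ge0// ltW.
have me : 0 <= (m0 * eps)^-1 by rewrite invr_ge0 mulr_ge0// ltW.
have h1 : 0 <= (2 * eps)^-1 * ((e0 + h) * B ^+ 2).
  by apply: mulr_ge0 => //; apply: mulr_ge0 => //; exact: sqr_ge0.
have h2 : 0 <= (m0 * eps)^-1 * (d * h + m0 * B / 2) ^+ 2.
  by apply: mulr_ge0 => //; exact: sqr_ge0.
have h3 : 0 <= 2^-1 * (h + (1 - s) * d * px) ^+ 2.
  by apply: mulr_ge0; [rewrite invr_ge0|exact: sqr_ge0].
have h4 : 0 <= (2 * eps)^-1 * ((e0 - m0 + k) * (B + (1 + s) * d) ^+ 2).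
  by apply: mulr_ge0 => //; apply: mulr_ge0 => //; exact: sqr_ge0.
have h5 : 0 <= (4 * eps)^-1 * (((m0 - 4 * k - m') + 2 * k) * B ^+ 2).
  apply: mulr_ge0 => //; apply: mulr_ge0; last exact: sqr_ge0.
  by apply: addr_ge0; [rewrite subr_ge0|rewrite mulr_ge0].
apply: le_trans (addr_ge0 (addr_ge0 (addr_ge0 (addr_ge0 h1 h2) h3) h4) h5) _.
by rewrite le_eqVlt; apply/orP; left; apply/eqP; field; rewrite !gt_eqF.
Qed.

(** A first time at which the threshold [b] is reached would be preceded by an
    interval on which the quantity does not increase. *)
Lemma stays_below (R : realType) (E : R -> R) (E0 b : R) :
  (forall t : R, 0 < t -> derivable E t 1) ->
  (forall t : R, 0 < t -> E t < b -> derive1 E t <= 0) ->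
  (forall e : R, 0 < e -> \forall t \near 0^'+, E t < E0 + e) ->
  E0 < b -> forall t : R, 0 < t -> E t < b.
Proof.
move=> dE dE0 lim E0b t1 t10; rewrite ltNge; apply/negP => Eb.
have cE z : 0 < z -> {for z, continuous E}.
  by move=> /dE d; exact/differentiable_continuous/derivable1_diffP.
have e0 : 0 < b - E0 by rewrite subr_gt0.
have H := lim _ e0.
have : \forall s \near 0^'+, [/\ 0 < s, s < t1 & E s < b].
  near=> s; split; near: s; [exact: nbhs_right_gt|exact: nbhs_right_lt|].
  by apply: filterS H => s; rewrite addrC subrK.
move=> /filter_ex[s [s0 st Es]].
pose A : set R := [set r | s <= r /\ b <= E r].
have A1 : A t1 by split => //; exact: ltW.
have lbA : has_lbound A by exists s => r [].
have infA : has_inf A by split => //; exists t1.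
pose z := inf A.
have sz : s <= z by apply: lb_le_inf => //; [exists t1|move=> r []].
have z0 := lt_le_trans s0 sz.
have below r : s <= r < z -> E r < b.
  move=> /andP[sr rz]; rewrite ltNge; apply/negP => bE.
  by have := ge_inf lbA (conj sr bE : A r); rewrite leNgt rz.
have bEz : b <= E z.
  rewrite leNgt; apply/negP => Ezb.
  have /nbhs_ballP[r /= r0 Hr] : \forall y \near z, E y < b.
    exact: (@cvgr_lt _ _ (nbhs z) _ E (E z) (cE z z0) b Ezb).
  have [y Ay yz] := inf_adherent r0 infA.
  have zy : z <= y := ge_inf lbA Ay.
  have : E y < b.
    apply: Hr; rewrite /ball/= ler0_norm ?subr_le0// opprB.
    by rewrite ltrBlDl.
  by case: Ay => _; rewrite leNgt => /negP.
have sltz : s < z.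
  rewrite lt_neqAle sz andbT; apply/eqP => sz'.
  by move: bEz; rewrite -sz' leNgt Es.
have : E z <= E s.
  apply: (@ler0_derive1_nincr _ E s z) => // [x|x|].
  - by rewrite in_itv/= => /andP[sx _]; exact: dE (lt_trans s0 sx).
  - rewrite in_itv/= => /andP[sx xz]; apply: dE0; first exact: lt_trans s0 sx.
    by apply: below; rewrite (ltW sx).
  - apply: derivable_within_continuous => x; rewrite in_itv/= => /andP[sx _].
    exact: dE (lt_le_trans s0 sx).
by move=> /(le_trans bEz); rewrite leNgt Es.
Unshelve. all: by end_near. Qed.

Section constants.
Context {R : realType} {m0 phi1 : R}.
Context (m0_gt0 : 0 < m0) (phi1_gt0 : 0 < phi1).

Let M_gt0 : 0 < Mconst m0 phi1.
Proof. by rewrite sqrtr_gt0 divr_gt0// mulr_gt0// expR_gt0. Qed.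

Lemma Mconst_gt0 : 0 < Mconst m0 phi1. Proof. exact: M_gt0. Qed.

Let exp_quotient (y : R) : 0 < `|y| <= phi1 -> `|expR y - 1| / `|y| <= expR phi1.
Proof.
move=> /andP[y0 yphi]; rewrite ler_pdivrMr//.
have h : expR `|y| <= expR phi1 by rewrite ler_expR.
apply: (@le_trans _ _ (expR `|y| * `|y|)); last by rewrite ler_wpM2r.
have [yp|yn] := leP 0 y.
  have E1 : 1 <= expR y by rewrite -expR0 ler_expR.
  rewrite ger0_norm ?subr_ge0// ger0_norm//.
  have := expR_ge1Dx (- y); rewrite expRN.
  by rewrite -(ler_pM2l (expR_gt0 y)) mulfV ?gt_eqF ?expR_gt0//; lra.
have E1 : expR y <= 1 by rewrite -expR0 ler_expR ltW.
rewrite ler0_norm ?subr_le0// ltr0_norm// opprB.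
have := expR_ge1Dx y => h1; have h2 : 1 <= expR (- y).
  by rewrite -expR0 ler_expR oppr_ge0 ltW.
have h3 : 0 <= - y by rewrite oppr_ge0 ltW.
nra.
Qed.

Lemma K0const_ge : expR phi1 - 1 <= K0const phi1 * phi1.
Proof.
have h : (expR phi1 - 1) / phi1 <= K0const phi1.
  apply: ub_le_sup; first by exists (expR phi1) => _ [y /= y1 <-]; exact: exp_quotient.
  have e1 : 0 <= expR phi1 - 1 by rewrite subr_ge0 -expR0 ler_expR ltW.
  exists phi1; first by rewrite /= gtr0_norm// phi1_gt0 lexx.
  by rewrite ger0_norm// gtr0_norm.
by rewrite -ler_pdivrMr.
Qed.

Lemma K0const_gt0 : 0 < K0const phi1 * phi1.
Proof. by apply: lt_le_trans K0const_ge; rewrite subr_gt0 -expR0 ltr_expR. Qed.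

(** The left side is the strength of the steady boundary layer; the right side is
    the constant in which the hypotheses of the theorem are expressed. *)
Lemma layer_constant eps : 0 < eps ->
  Num.sqrt (m0 * eps) * (expR phi1 - 1)
  <= m0 * (K0const phi1 * phi1) * (Num.sqrt eps / Mconst m0 phi1).
Proof.
move=> e0; have M0 := M_gt0.
have sm : Num.sqrt m0 <= m0 / Mconst m0 phi1.
  rewrite ler_pdivlMr//; apply: le_of_sqr; first exact: ltW.
  have q0 : 0 <= m0 / (2 * expR phi1).
    by rewrite divr_ge0 ?mulr_ge0 ?expR_ge0// ltW.
  rewrite exprMn /Mconst !sqr_sqrtr ?(ltW m0_gt0)// expr2 ler_wpM2l ?(ltW m0_gt0)//.
  have e1 : 1 <= expR phi1 by rewrite -expR0 ler_expR ltW.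
  rewrite ler_pdivrMr ?mulr_gt0 ?expR_gt0// ler_pMr//; lra.
have -> : m0 * (K0const phi1 * phi1) * (Num.sqrt eps / Mconst m0 phi1)
    = m0 / Mconst m0 phi1 * Num.sqrt eps * (K0const phi1 * phi1).
  by field; rewrite gt_eqF.
rewrite sqrtrM; last exact: ltW.
apply: ler_pM.
- by rewrite mulr_ge0 ?sqrtr_ge0.
- by rewrite subr_ge0 -expR0 ler_expR ltW.
- by rewrite ler_wpM2r ?sqrtr_ge0.
- exact: K0const_ge.
Qed.

End constants.

(** * The perturbed system *)

Section perturbation.
Context {R : realType} {m0 phi1 eps gam : R} {psi : R -> R}
  {delta eta phi : R -> R -> R}.
Context (m0_gt0 : 0 < m0) (phi1_gt0 : 0 < phi1) (eps_gt0 : 0 < eps)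
  (gam_gt0 : 0 < gam) (ss : steady_state m0 phi1 eps gam psi)
  (np : NP_solution m0 eps gam psi delta eta phi)
  (delta_init : sq_integrable (delta ^~ 0))
  (eta_init : sq_integrable (eta ^~ 0))
  (mass_delta : itg (-1) 1 (delta ^~ 0) = 0)
  (mass_eta : itg (-1) 1 (eta ^~ 0) = 0).
Implicit Types (x y z t s e T : R).
Notation mu := (@lebesgue_measure R).

Let D x t := itg (-1) x (delta ^~ t).
Let H x t := itg (-1) x (eta ^~ t).
Let d t := 2^-1 * itg (-1) 1 (D ^~ t).
Let E0 := eta0 m0 psi.
Let Q0 := delta0 m0 psi.
Let P := dI psi.
Let Fd := flux_delta m0 psi delta eta phi.
Let Fe := flux_eta m0 psi delta eta phi.

Let N11 : -1 < 1 :> R := ltN11 R.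
Let leN11 : -1 <= 1 :> R := ltW N11.

Let dE0 x : -1 < x < 1 -> is_derive x 1 E0 (Q0 x * P x).
Proof.
move=> x1; have := is_derive_fctD (is_derive_cations0 ss x1)
  (is_derive_anions0 ss x1).
by move/is_derive_eq; apply; rewrite -mulrBl.
Qed.

Let dQ0 x : -1 < x < 1 -> is_derive x 1 Q0 (E0 x * P x).
Proof.
move=> x1; have := is_derive_fctB (is_derive_cations0 ss x1)
  (is_derive_anions0 ss x1).
by move/is_derive_eq; apply; rewrite opprK -mulrDl.
Qed.

Let dP x : -1 < x < 1 -> is_derive x 1 P (Q0 x / eps).
Proof. by move=> x1; exact: (is_derive_field eps_gt0 ss x1). Qed.

Let cE0 : {within `[-1, 1], continuous E0} := eta0_continuous ss.
Let cQ0 : {within `[-1, 1], continuous Q0} := delta0_continuous ss.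
Let cP : {within `[-1, 1], continuous P} := field_continuous ss.

Let cdelta : contQ delta. Proof. by case: (np_delta_x np) => -[]. Qed.
Let ceta : contQ eta. Proof. by case: (np_eta_x np) => -[]. Qed.
Let cdx_delta : contQ (dx delta). Proof. by case: (np_delta_x np) => -[]. Qed.
Let cdx_eta : contQ (dx eta). Proof. by case: (np_eta_x np) => -[]. Qed.
Let cdx_phi : contQ (dx phi). Proof. by case: (np_phi_x np) => -[]. Qed.

Let cFd : contQ Fd.
Proof. exact: contQ_flux (np_delta_x np) (np_eta_x np) (np_phi_x np) cE0 cP. Qed.

Let cFe : contQ Fe.
Proof. exact: contQ_flux (np_eta_x np) (np_delta_x np) (np_phi_x np) cQ0 cP. Qed.

Let dFd x t : -1 < x < 1 -> 0 < t -> is_derive x 1 (Fd ^~ t) (dt delta x t).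
Proof.
exact: (is_derive_flux (np_delta_x np) (np_eta_x np) (np_phi_x np) dE0 dP
  (np_delta_eq np)).
Qed.

Let dFe x t : -1 < x < 1 -> 0 < t -> is_derive x 1 (Fe ^~ t) (dt eta x t).
Proof.
exact: (is_derive_flux (np_eta_x np) (np_delta_x np) (np_phi_x np) dQ0 dP
  (np_eta_eq np)).
Qed.

Let D_t x t : -1 <= x <= 1 -> 0 < t -> is_derive t 1 (D x) (Fd x t).
Proof.
exact: (is_derive_primitive_time (np_delta_x np) (np_delta_t np) (np_eta_x np)
  (np_phi_x np) cE0 cP dE0 dP (np_delta_eq np) (np_flux_delta np)).
Qed.

Let H_t x t : -1 <= x <= 1 -> 0 < t -> is_derive t 1 (H x) (Fe x t).
Proof.
exact: (is_derive_primitive_time (np_eta_x np) (np_eta_t np) (np_delta_x np)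
  (np_phi_x np) cQ0 cP dQ0 dP (np_eta_eq np) (np_flux_eta np)).
Qed.

Let D_right t : 0 < t -> D 1 t = 0.
Proof.
exact: (primitive_right (np_delta_x np) (np_delta_t np) (np_eta_x np)
  (np_phi_x np) cE0 cP dE0 dP (np_delta_eq np) (np_flux_delta np)
  delta_init (np_delta_init np) mass_delta).
Qed.

Let H_right t : 0 < t -> H 1 t = 0.
Proof.
exact: (primitive_right (np_eta_x np) (np_eta_t np) (np_delta_x np)
  (np_phi_x np) cQ0 cP dQ0 dP (np_eta_eq np) (np_flux_eta np)
  eta_init (np_eta_init np) mass_eta).
Qed.

Let D_left t : D (-1) t = 0. Proof. exact: primitive_left. Qed.
Let H_left t : H (-1) t = 0. Proof. exact: primitive_left. Qed.

Let cD t : 0 < t -> {within `[-1, 1], continuous (D ^~ t)}.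
Proof. by move=> t0; exact: (primitive_slice (np_delta_x np) t0). Qed.

Let cH t : 0 < t -> {within `[-1, 1], continuous (H ^~ t)}.
Proof. by move=> t0; exact: (primitive_slice (np_eta_x np) t0). Qed.

(** Integrating Poisson's equation once gives the field up to a constant, which
    the Robin conditions fix. *)
Lemma perturbed_field x t : -1 <= x <= 1 -> 0 < t ->
  eps * dx phi x t = D x t - d t / (1 + gam).
Proof.
move=> x1 t0; have g1 : 1 + gam != 0 by rewrite gt_eqF// addr_gt0.
have e0 : eps != 0 by rewrite gt_eqF.
have cph : {within `[-1, 1], continuous (dx phi ^~ t)} := contQ_slice cdx_phi t0.
have cde : {within `[-1, 1], continuous (delta ^~ t)} := contQ_slice cdelta t0.
have cph0 : {within `[-1, 1], continuous (phi ^~ t)}.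
  by apply: contQ_slice t0; case: (np_phi_x np) => -[].
have D1 y : -1 <= y <= 1 -> eps * dx phi y t = D y t + eps * dx phi (-1) t.
  move=> /andP[y1 y2].
  have sub : (`[-1, y] : set R) `<=` `[-1, 1] by apply: subset_itvl; rewrite bnd_simp.
  have dp z : -1 < z < y -> is_derive z 1 (fun z => eps * dx phi z t) (delta z t).
    move=> /andP[z1 zy]; have z11 : -1 < z < 1 by rewrite z1 (lt_le_trans zy).
    rewrite -(np_poisson np z11 t0); apply: is_derive_fctZ.
    exact: C1x_is_derive (np_phi_x np).2 z11 t0.
  have := FTC y1 (continuous_subspaceW sub (within_mul (within_cst _ eps) cph))
    (continuous_subspaceW sub cde) dp.
  by rewrite -/(D y t) => ->; rewrite subrK.
have dp z : -1 < z < 1 -> is_derive z 1 (phi ^~ t) (dx phi z t).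
  by move=> z1; exact: C1x_is_derive (np_phi_x np).1 z1 t0.
have := FTC leN11 cph0 cph dp.
have := np_robin_right np t0; have := np_robin_left np t0.
have := D1 1; rewrite D_right// leN11 lexx add0r => /(_ isT)/(mulfI e0) ->.
set c := dx phi (-1) t => rl rr I1.
have : eps * itg (-1) 1 (dx phi ^~ t) = itg (-1) 1 (D ^~ t) + eps * c * 2.
  rewrite -(int_scale _ cph) (int_eq D1).
  rewrite (int_add (cD t0) (within_cst _ (eps * dx phi (-1) t))) int_cst//.
  by rewrite opprK.
rewrite I1 => I2; rewrite D1// -/c; congr (_ + _); rewrite /d.
have -> : itg (-1) 1 (D ^~ t) = eps * (phi 1 t - phi (-1) t) - eps * c * 2.
  by rewrite I2 addrK.
have -> : phi 1 t = - (gam * c) by apply/eqP; rewrite -addr_eq0 rr.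
have -> : phi (-1) t = gam * c by apply/eqP; rewrite -subr_eq0 rl.
by field.
Qed.

(** Near the initial time the bound comes from convergence in [L^1], later from
    compactness. *)
Let bounded_from0 (u : R -> R -> R) : contQ u -> sq_integrable (u ^~ 0) ->
  L2norm (fun x => u x t - u x 0) @[t --> 0^'+] --> 0%E ->
  locally_boundedQ (fun x t => itg (-1) x (u ^~ t)) ->
  forall T, exists C : R, forall x t, -1 <= x <= 1 -> 0 < t <= T ->
    `|itg (-1) x (u ^~ t)| <= C.
Proof.
move=> cu u0 lim bu T.
have cus s : 0 < s -> {within `[-1, 1], continuous (u ^~ s)} by exact: contQ_slice.
have Hl := L2_cvg_norm cus u0 lim (@ltr01 R).
have : \forall s \near 0^'+, 0 < s /\
    forall t, 0 < t <= s -> itg (-1) 1 (fun x => `|u x t - u x 0|) < 1.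
  move: Hl; rewrite /at_right /= !near_withinE => /nbhs_ballP[r /= r0 Hr].
  apply/nbhs_ballP; exists r => //= s sr s0; split => // t /andP[t0 ts].
  apply: (Hr t) => //; rewrite /ball/= sub0r normrN gtr0_norm//.
  apply: le_lt_trans ts _; move: sr; rewrite /ball/= sub0r normrN gtr0_norm//.
move=> /filter_ex[s [s0 Hs]].
have [C HC] := bu s T s0.
have I0 := sq_integrable_integrable u0.
pose C0 := itg (-1) 1 (fun x => `|u x 0 - 0|).
have C00 : 0 <= C0 by apply: int_ge0.
exists (`|C| + 1 + C0) => x t x1 /andP[t0 tT]; have [st|ts] := ltP s t.
  apply: (@le_trans _ _ `|C|); last by rewrite -addrA lerDl addr_ge0.
  by apply: le_trans (ler_norm C); apply: HC => //; rewrite ltW.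
have h1 := primitive_dist x1 (integrable_within (cus t t0)) I0.
have := @primitive_dist _ (u ^~ 0) (fun=> 0) x x1 I0 (integrable_within (within_cst _ 0)).
rewrite int_cst; last by case/andP: x1.
rewrite mul0r subr0 -/C0 => h2.
have h3 : itg (-1) 1 (fun x => `|u x t - u x 0|) < 1 by apply: Hs; rewrite t0.
rewrite -(subrK (itg (-1) x (u ^~ 0)) (itg (-1) x (u ^~ t))).
apply: le_trans (ler_normD _ _) _; apply: lerD h2.
by apply: le_trans h1 _; apply: le_trans (ltW h3) _; rewrite lerDr.
Qed.

Let bD := locally_boundedQ_primitive (np_delta_x np).
Let bH := locally_boundedQ_primitive (np_eta_x np).

(** The total field is the drift velocity of both species, up to sign. *)
Lemma field_bounded T : exists C : R, forall x t, -1 <= x <= 1 -> 0 < t <= T ->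
  `|P x + dx phi x t| <= C.
Proof.
have [C HC] := bounded_from0 cdelta delta_init (np_delta_init np) bD T.
have [K K0 HK] := within_bounded cP.
exists (K + (C + C) / eps) => x t x1 tT; have /andP[t0 _] := tT.
apply: le_trans (ler_normD _ _) _; apply: lerD; first exact: HK.
rewrite ler_pdivlMr// mulrC -{1}(gtr0_norm eps_gt0) -normrM perturbed_field//.
apply: le_trans (ler_normB _ _) _; apply: lerD; first exact: HC.
have h : `|itg (-1) 1 (D ^~ t)| <= C * (1 - -1).
  apply: int_norm_le (cD t0) _ => // y /andP[y1 y2]; apply: HC => //.
  by rewrite !ltW.
have C0 : 0 <= C by apply: le_trans (HC x t x1 tT).
have g1 : 1 <= 1 + gam by rewrite lerDl ltW.
rewrite normrM normfV [`|1 + gam|]gtr0_norm; last by apply: lt_le_trans g1.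
rewrite ler_pdivrMr; last by apply: lt_le_trans g1.
apply: (@le_trans _ _ C); last by rewrite ler_peMr.
rewrite /d normrM gtr0_norm ?invr_gt0//.
by rewrite mulrC ler_pdivrMr//; move: h; rewrite opprK.
Qed.

Let nprof := fun x => cations0 m0 psi x + 2^-1 * (delta x 0 + eta x 0).
Let pprof := fun x => anions0 m0 psi x + 2^-1 * (eta x 0 - delta x 0).

Context (nprof_ge0 : forall x, -1 < x < 1 -> 0 <= nprof x)
  (pprof_ge0 : forall x, -1 < x < 1 -> 0 <= pprof x).

(** The negative part of a density is at most its distance to a nonnegative
    initial profile, so it vanishes in the limit of small times. *)
Let negcost_small (u : R -> R -> R) (v : R -> R) :
  contQ u -> (forall x, -1 < x < 1 -> 0 <= v x) ->
  (forall x t, (u x t - v x) ^+ 2 <=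
    (delta x t - delta x 0) ^+ 2 + (eta x t - eta x 0) ^+ 2) ->
  forall e, 0 < e -> \forall t \near 0^'+, itg (-1) 1 (fun x => negcost (u x t)) < e.
Proof.
move=> cu v0 uv e e0; have e2 : 0 < e / 2 by rewrite divr_gt0.
have cd t : 0 < t -> {within `[-1, 1], continuous (delta ^~ t)} by exact: contQ_slice.
have ce t : 0 < t -> {within `[-1, 1], continuous (eta ^~ t)} by exact: contQ_slice.
have hd := L2_cvg_sqr cd delta_init (np_delta_init np) e2.
have he := L2_cvg_sqr ce eta_init (np_eta_init np) e2.
near=> t; have t0 : 0 < t by near: t; exact: nbhs_right_gt.
have kd : itg (-1) 1 (fun x => (delta x t - delta x 0) ^+ 2) < e / 2 by near: t.
have ke : itg (-1) 1 (fun x => (eta x t - eta x 0) ^+ 2) < e / 2 by near: t.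
rewrite [ltRHS]splitr; apply: le_lt_trans (ltrD kd ke).
have [_ I1] := sq_integrableB (sq_integrable_within (cd t t0)) delta_init.
have [_ I2] := sq_integrableB (sq_integrable_within (ce t t0)) eta_init.
rewrite -[leRHS]RintegralD//.
apply: int_le_integrable.
- apply: integrable_within; apply: within_comp (contQ_slice cu t0).
  exact: negcost_continuous.
- exact: integrable_fctD I1 I2.
- by move=> x x1; apply: le_trans (uv x t); apply: negcost_le_sqr; exact: v0.
Unshelve. all: by end_near. Qed.

Let dd x t : -1 < x < 1 -> 0 < t -> is_derive x 1 (delta ^~ t) (dx delta x t).
Proof. by move=> x1 t0; exact: (C1x_is_derive (np_delta_x np).1 x1 t0). Qed.

Let de x t : -1 < x < 1 -> 0 < t -> is_derive x 1 (eta ^~ t) (dx eta x t).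
Proof. by move=> x1 t0; exact: (C1x_is_derive (np_eta_x np).1 x1 t0). Qed.

(** Half the sum of the two perturbed equations is the drift-diffusion equation of
    the cations, whose steady flux vanishes because [cations0] has derivative
    [cations0 * psi'] for the steady field [psi']. *)
Lemma cations_ge0 x t : -1 < x < 1 -> 0 < t ->
  0 <= cations0 m0 psi x + 2^-1 * (delta x t + eta x t).
Proof.
have cn := cations0_continuous ss.
have h := within_cst (`[-1, 1] `*` `]0, +oo[ : set (R * R)) (2^-1 : R).
apply: (@drift_diffusion_ge0 R
  (fun x t => cations0 m0 psi x + 2^-1 * (delta x t + eta x t))
  (fun x t => cations0 m0 psi x * P x + 2^-1 * (dx delta x t + dx eta x t))
  (fun x t => 2^-1 * (dt delta x t + dt eta x t))
  (fun x t => 2^-1 * (Fd x t + Fe x t))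
  (fun x t => P x + dx phi x t)).
- exact: within_add (contQ_space cn) (within_mul h (within_add cdelta ceta)).
- exact: within_add (contQ_space (within_mul cn cP))
    (within_mul h (within_add cdx_delta cdx_eta)).
- exact: within_mul h (within_add (np_delta_t np).2 (np_eta_t np).2).
- exact: within_mul h (within_add cFd cFe).
- move=> y s y1 s0; apply: is_derive_fctD (is_derive_cations0 ss y1) _.
  by apply: is_derive_fctZ; apply: is_derive_fctD; [exact: dd|exact: de].
- move=> y s y1 s0.
  have := is_derive_fctD (is_derive_fct_cst s (cations0 m0 psi y)) (is_derive_fctZ 2^-1
    (is_derive_fctD (C1t_is_derive (np_delta_t np) y1 s0)
      (C1t_is_derive (np_eta_t np) y1 s0))).
  by rewrite add0r.
- by move=> y s y1 s0; apply: is_derive_fctZ; apply: is_derive_fctD; [exact: dFd|exact: dFe].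
- move=> s s0; have [a1 a2] := np_flux_delta np s0; have [b1 b2] := np_flux_eta np s0.
  by rewrite /Fd /Fe a1 a2 b1 b2 addr0 mulr0.
- move=> y s _ _; rewrite /Fd /Fe /flux_delta /flux_eta /eta0 /delta0 -/P.
  by field.
- exact: field_bounded.
- apply: (negcost_small _ nprof_ge0).
    exact: within_add (contQ_space cn) (within_mul h (within_add cdelta ceta)).
  move=> y s; rewrite /nprof -subr_ge0.
  rewrite (_ : _ - _ = 2^-1 * ((delta y s - delta y 0) ^+ 2 + (eta y s - eta y 0) ^+ 2)
    + 4^-1 * (delta y s - delta y 0 - (eta y s - eta y 0)) ^+ 2); last by field.
  by apply: addr_ge0; apply: mulr_ge0; rewrite // ?addr_ge0 ?sqr_ge0.
Qed.

Lemma anions_ge0 x t : -1 < x < 1 -> 0 < t ->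
  0 <= anions0 m0 psi x + 2^-1 * (eta x t - delta x t).
Proof.
have cn := anions0_continuous ss.
have h := within_cst (`[-1, 1] `*` `]0, +oo[ : set (R * R)) (2^-1 : R).
apply: (@drift_diffusion_ge0 R
  (fun x t => anions0 m0 psi x + 2^-1 * (eta x t - delta x t))
  (fun x t => - (anions0 m0 psi x * P x) + 2^-1 * (dx eta x t - dx delta x t))
  (fun x t => 2^-1 * (dt eta x t - dt delta x t))
  (fun x t => 2^-1 * (Fe x t - Fd x t))
  (fun x t => - (P x + dx phi x t))).
- exact: within_add (contQ_space cn) (within_mul h (within_sub ceta cdelta)).
- exact: within_add (contQ_space (within_opp (within_mul cn cP)))
    (within_mul h (within_sub cdx_eta cdx_delta)).
- exact: within_mul h (within_sub (np_eta_t np).2 (np_delta_t np).2).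
- exact: within_mul h (within_sub cFe cFd).
- move=> y s y1 s0; apply: is_derive_fctD (is_derive_anions0 ss y1) _.
  by apply: is_derive_fctZ; apply: is_derive_fctB; [exact: de|exact: dd].
- move=> y s y1 s0.
  have := is_derive_fctD (is_derive_fct_cst s (anions0 m0 psi y)) (is_derive_fctZ 2^-1
    (is_derive_fctB (C1t_is_derive (np_eta_t np) y1 s0)
      (C1t_is_derive (np_delta_t np) y1 s0))).
  by rewrite add0r.
- by move=> y s y1 s0; apply: is_derive_fctZ; apply: is_derive_fctB; [exact: dFe|exact: dFd].
- move=> s s0; have [a1 a2] := np_flux_delta np s0; have [b1 b2] := np_flux_eta np s0.
  by rewrite /Fd /Fe a1 a2 b1 b2 subr0 mulr0.
- move=> y s _ _; rewrite /Fd /Fe /flux_delta /flux_eta /eta0 /delta0 -/P.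
  by field.
- move=> T; have [C HC] := field_bounded T; exists C => y s y1 s0.
  by rewrite normrN; exact: HC.
- apply: (negcost_small _ pprof_ge0).
    exact: within_add (contQ_space cn) (within_mul h (within_sub ceta cdelta)).
  move=> y s; rewrite /pprof -subr_ge0.
  rewrite (_ : _ - _ = 2^-1 * ((delta y s - delta y 0) ^+ 2 + (eta y s - eta y 0) ^+ 2)
    + 4^-1 * (delta y s - delta y 0 + (eta y s - eta y 0)) ^+ 2); last by field.
  by apply: addr_ge0; apply: mulr_ge0; rewrite // ?addr_ge0 ?sqr_ge0.
Qed.

Lemma total_concentration_ge0 x t : -1 < x < 1 -> 0 < t -> 0 <= E0 x + eta x t.
Proof.
move=> x1 t0; have := cations_ge0 x1 t0; have := anions_ge0 x1 t0.
rewrite /E0 /eta0; lra.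
Qed.

Let h t := 2^-1 * itg (-1) 1 (H ^~ t).

Let centred_square (f : R -> R) : {within `[-1, 1], continuous f} ->
  itg (-1) 1 (fun x => (f x - 2^-1 * itg (-1) 1 f) ^+ 2)
  = itg (-1) 1 (fun x => f x ^+ 2) - 2 * (2^-1 * itg (-1) 1 f) ^+ 2.
Proof.
move=> cf; set m := 2^-1 * _.
have c1 := within_exp 2 cf; have c2 := within_mul (within_cst _ (2 * m)) cf.
rewrite (int_eq (g := fun x => f x ^+ 2 - 2 * m * f x + m ^+ 2)); last first.
  by move=> x _; ring.
rewrite (int_add (within_sub c1 c2) (within_cst _ (m ^+ 2))) (int_sub c1 c2).
rewrite (int_scale _ cf) int_cst// (_ : itg (-1) 1 f = 2 * m); first by ring.
by rewrite /m; field.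
Qed.

(** Constants are orthogonal to functions of mean zero, and the interval has
    length 2. *)
Lemma energy_primitives t : {within `[-1, 1], continuous (D ^~ t)} ->
  {within `[-1, 1], continuous (H ^~ t)} ->
  energy delta eta t = 2^-1 * itg (-1) 1 (fun x => D x t * D x t + H x t * H x t).
Proof.
move=> cDt cHt.
have -> : energy delta eta t = 2^-1 * itg (-1) 1
    (fun x => (D x t - d t) ^+ 2 + (H x t - h t) ^+ 2) + d t ^+ 2 + h t ^+ 2 by [].
rewrite (int_add (within_exp 2 (within_sub cDt (within_cst _ (d t))))
  (within_exp 2 (within_sub cHt (within_cst _ (h t))))).
rewrite (int_add (within_mul cDt cDt) (within_mul cHt cHt)).
rewrite (centred_square cDt) (centred_square cHt) -/(d t) -/(h t).
by field.
Qed.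

Lemma is_derive_energy t : 0 < t -> is_derive t 1 (energy delta eta)
  (itg (-1) 1 (fun x => D x t * Fd x t + H x t * Fe x t)).
Proof.
move=> t0.
pose u x s := D x s * D x s + H x s * H x s.
pose ut x s := Fd x s * D x s + D x s * Fd x s + (Fe x s * H x s + H x s * Fe x s).
have cu s : 0 < s -> {within `[-1, 1], continuous (u ^~ s)}.
  move=> s0; apply: within_add.
    exact: within_mul (cD s0) (cD s0).
  exact: within_mul (cH s0) (cH s0).
have du x s : -1 <= x <= 1 -> 0 < s -> is_derive s 1 (u x) (ut x s).
  by move=> x1 s0; apply: is_derive_fctD; apply: is_derive_fctM;
    (exact: D_t || exact: H_t).
have bFd := contQ_bounded cFd; have bFe := contQ_bounded cFe.
have but : locally_boundedQ ut.
  apply: locally_boundedQD; apply: locally_boundedQD; apply: locally_boundedQM;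
    by [exact: bFd|exact: bFe|exact: bD|exact: bH].
have := is_derive_fctZ 2^-1 (is_derive_int (lexx (-1)) (lexx 1) cu du but t0).
have c : {within `[-1, 1], continuous (fun x => D x t * Fd x t + H x t * Fe x t)}.
  apply: within_add.
    exact: within_mul (cD t0) (contQ_slice cFd t0).
  exact: within_mul (cH t0) (contQ_slice cFe t0).
rewrite (int_eq (f := ut ^~ t) (g := fun x => 2 * (D x t * Fd x t + H x t * Fe x t)));
  last by move=> x _; rewrite /ut; ring.
rewrite (int_scale 2 c) mulrA mulVf ?mul1r//.
apply: near_eq_is_derive; apply: filterS (lt_nbhsr t0) => s s0.
by rewrite (energy_primitives (cD s0) (cH s0)).
Qed.

(** The terms in [delta0 * D * H] produced by the drift cancel those produced by
    Poisson's equation; everything else not on the right is the derivative of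
    [G], which vanishes at both walls. *)
Lemma dissipation_identity t : 0 < t ->
  itg (-1) 1 (fun x => D x t * Fd x t + H x t * Fe x t) =
  itg (-1) 1 (fun x => - delta x t ^+ 2 - eta x t ^+ 2 - E0 x * dx phi x t * D x t
    - D x t ^+ 2 * eta x t / (2 * eps) - d t / (1 + gam) * P x * eta x t).
Proof.
move=> t0; have e0 : eps != 0 by rewrite gt_eqF.
have g1 : 1 + gam != 0 by rewrite gt_eqF// addr_gt0.
have cDt := cD t0; have cHt := cH t0.
have cde : {within `[-1, 1], continuous (delta ^~ t)} := contQ_slice cdelta t0.
have cet : {within `[-1, 1], continuous (eta ^~ t)} := contQ_slice ceta t0.
have cph : {within `[-1, 1], continuous (dx phi ^~ t)} := contQ_slice cdx_phi t0.
pose r := d t / (1 + gam).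
pose f x := D x t * Fd x t + H x t * Fe x t.
pose q x := - delta x t ^+ 2 - eta x t ^+ 2 - E0 x * dx phi x t * D x t
    - D x t ^+ 2 * eta x t / (2 * eps) - r * P x * eta x t.
have cf : {within `[-1, 1], continuous f}.
  apply: within_add.
    exact: within_mul cDt (contQ_slice cFd t0).
  exact: within_mul cHt (contQ_slice cFe t0).
have cq : {within `[-1, 1], continuous q}.
  apply: within_sub (within_mul (within_mul (within_cst _ r) cP) cet).
  apply: within_sub; last first.
    exact: within_mul (within_mul (within_exp 2 cDt) cet) (within_cst _ (2 * eps)^-1).
  apply: within_sub (within_mul (within_mul cE0 cph) cDt).
  exact: within_sub (within_opp (within_exp 2 cde)) (within_exp 2 cet).
pose G x := D x t * delta x t + H x t * eta x t
  - (P x + dx phi x t) * (D x t * H x t)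
  + (2 * eps)^-1 * (D x t ^+ 2 * H x t) + r * (P x * H x t).
have cG : {within `[-1, 1], continuous G}.
  apply: within_add (within_mul (within_cst _ r) (within_mul cP cHt)).
  apply: within_add (within_mul (within_cst _ (2 * eps)^-1)
    (within_mul (within_exp 2 cDt) cHt)).
  apply: within_sub (within_mul (within_add cP cph) (within_mul cDt cHt)).
  exact: within_add (within_mul cDt cde) (within_mul cHt cet).
have dG x : -1 < x < 1 -> is_derive x 1 G (f x - q x).
  move=> x1; have x1' : -1 <= x <= 1 by case/andP: x1 => /ltW -> /ltW ->.
  have dDx : is_derive x 1 (D ^~ t) (delta x t).
    exact: (is_derive_primitive_slice (np_delta_x np)).
  have dHx : is_derive x 1 (H ^~ t) (eta x t).
    exact: (is_derive_primitive_slice (np_eta_x np)).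
  have dph := C1x_is_derive (np_phi_x np).2 x1 t0.
  have := is_derive_fctD (is_derive_fctD (is_derive_fctB
    (is_derive_fctD (is_derive_fctM dDx (dd x1 t0)) (is_derive_fctM dHx (de x1 t0)))
    (is_derive_fctM (is_derive_fctD (dP x1) dph) (is_derive_fctM dDx dHx)))
    (is_derive_fctZ (2 * eps)^-1 (is_derive_fctM (is_derive_fctX 1 dDx) dHx)))
    (is_derive_fctZ r (is_derive_fctM (dP x1) dHx)).
  move/is_derive_eq; apply.
  have -> : dx (dx phi) x t = delta x t / eps.
    by rewrite -(np_poisson np x1 t0) mulrAC mulfV ?mul1r.
  rewrite /f /q /Fd /Fe /flux_delta /flux_eta -/E0 -/Q0 -/P.
  have -> : dx phi x t = (D x t - r) / eps.
    by rewrite -(perturbed_field x1' t0) mulrAC mulfV ?mul1r.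
  by field.
have := FTC leN11 cG (within_sub cf cq) dG.
rewrite (int_sub cf cq) /G (D_right t0) (H_right t0) D_left H_left.
by rewrite !expr0n/= !(mul0r, mulr0, addr0, subr0) => /eqP; rewrite subr_eq0 => /eqP.
Qed.

Let s := gam / (1 + gam).

(** Integrating the pointwise bound, the terms linear in [D - d] and in [eta] drop
    out, and what remains is a multiple of [d ^+ 2] whose sign is the last
    hypothesis. *)
Lemma energy_dissipation (k m' : R) t : 0 < t -> 0 <= k -> m' <= m0 - 4 * k ->
  (forall x, 0 <= E0 x - m0 + k) ->
  eps / 2 * (1 - s) ^+ 2 * itg (-1) 1 (fun x => P x ^+ 2) + (1 + s) ^+ 2 * k
    <= 2 * m0 * s ->
  itg (-1) 1 (fun x => D x t * Fd x t + H x t * Fe x t) <=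
  - itg (-1) 1 (fun x => delta x t ^+ 2
                 + (2^-1 - d t ^+ 2 / (m0 * eps)) * eta x t ^+ 2)
  - (4 * eps)^-1 * m' * itg (-1) 1 (fun x => (D x t - d t) ^+ 2).
Proof.
move=> t0 k0 m'le w0 budget; rewrite (dissipation_identity t0).
have e0 : eps != 0 by rewrite gt_eqF.
have g1 : 1 + gam != 0 by rewrite gt_eqF// addr_gt0.
have cDt := cD t0; have cBt := within_sub cDt (within_cst _ (d t)).
have cde : {within `[-1, 1], continuous (delta ^~ t)} := contQ_slice cdelta t0.
have cet : {within `[-1, 1], continuous (eta ^~ t)} := contQ_slice ceta t0.
have cph : {within `[-1, 1], continuous (dx phi ^~ t)} := contQ_slice cdx_phi t0.
have cP2 := within_exp 2 cP.
set c := 2^-1 - _.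
pose q x := - delta x t ^+ 2 - eta x t ^+ 2 - E0 x * dx phi x t * D x t
    - D x t ^+ 2 * eta x t / (2 * eps) - d t / (1 + gam) * P x * eta x t.
pose f1 x := delta x t ^+ 2 + c * eta x t ^+ 2.
pose f2 x := (D x t - d t) ^+ 2.
rewrite -/q -/f1 -/f2.
have cq : {within `[-1, 1], continuous q}.
  apply: within_sub (within_mul (within_mul (within_cst _ (d t / (1 + gam))) cP) cet).
  apply: within_sub; last first.
    exact: within_mul (within_mul (within_exp 2 cDt) cet) (within_cst _ (2 * eps)^-1).
  apply: within_sub (within_mul (within_mul cE0 cph) cDt).
  exact: within_sub (within_opp (within_exp 2 cde)) (within_exp 2 cet).
have cf1 : {within `[-1, 1], continuous f1}.
  exact: within_add (within_exp 2 cde) (within_mul (within_cst _ c) (within_exp 2 cet)).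
have cf2 : {within `[-1, 1], continuous f2} := within_exp 2 cBt.
pose al := - ((1 + s) * d t * (m0 - k) / eps).
pose be := - (d t ^+ 2 / (2 * eps)).
pose ga := d t ^+ 2 / eps.
pose g1' x := eps / 2 * (1 - s) ^+ 2 * P x ^+ 2.
pose g2 x := (2^-1 * (1 + s) ^+ 2 - s) * E0 x + 2^-1 * (1 + s) ^+ 2 * (k - m0).
have cg1 : {within `[-1, 1], continuous g1'} := within_mul (within_cst _ _) cP2.
have cg2 : {within `[-1, 1], continuous g2}.
  exact: within_add (within_mul (within_cst _ _) cE0) (within_cst _ _).
have main : itg (-1) 1 (fun x => q x + f1 x + (4 * eps)^-1 * m' * f2 x) <=
    itg (-1) 1 (fun x => al * (D x t - d t) + be * eta x t + ga * (g1' x + g2 x)).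
  apply: int_le.
  - exact: within_add (within_add cq cf1) (within_mul (within_cst _ _) cf2).
  - exact: within_add (within_add (within_mul (within_cst _ al) cBt)
      (within_mul (within_cst _ be) cet)) (within_mul (within_cst _ ga) (within_add cg1 cg2)).
  - move=> x x1; have x1' : -1 <= x <= 1 by case/andP: x1 => /ltW -> /ltW ->.
    have pw := dissipation_pointwise s (d t) (delta x t) (D x t - d t) (P x)
      eps_gt0 m0_gt0 (total_concentration_ge0 x1 t0) (w0 x) k0 m'le.
    rewrite -subr_ge0 in pw; rewrite -subr_ge0; apply: le_trans pw _.
    rewrite le_eqVlt; apply/orP; left; apply/eqP.
    rewrite /q /f1 /f2 /c /al /be /ga /g1' /g2.
    have -> : dx phi x t = (D x t - d t + s * d t) / eps.
      apply: (mulfI e0); rewrite (perturbed_field x1' t0) /s; field.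
      by rewrite e0.
    by rewrite /s; field; rewrite e0 g1 gt_eqF.
move: main.
rewrite (int_add (within_add cq cf1) (within_mul (within_cst _ ((4 * eps)^-1 * m')) cf2)).
rewrite (int_add cq cf1) (int_scale _ cf2).
rewrite (int_add (within_add (within_mul (within_cst _ al) cBt)
      (within_mul (within_cst _ be) cet)) (within_mul (within_cst _ ga) (within_add cg1 cg2))).
rewrite (int_add (within_mul (within_cst _ al) cBt) (within_mul (within_cst _ be) cet)).
rewrite (int_scale al cBt) (int_scale be cet) (int_scale ga (within_add cg1 cg2)).
rewrite (int_sub cDt (within_cst _ (d t))) int_cst//.
have -> : itg (-1) 1 (D ^~ t) - d t * (1 - -1) = 0 by rewrite /d; field.
have -> : itg (-1) 1 (eta ^~ t) = 0 by exact: H_right.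
rewrite !mulr0 !add0r (int_add cg1 cg2) (int_scale _ cP2).
rewrite (int_add (within_mul (within_cst _ (2^-1 * (1 + s) ^+ 2 - s)) cE0)
  (within_cst _ (2^-1 * (1 + s) ^+ 2 * (k - m0)))).
rewrite (int_scale _ cE0) (int_eta0 ss) int_cst//.
set I1 := itg _ _ q; set I2 := itg _ _ f1; set I3 := itg _ _ f2; set I4 := itg _ _ _.
move=> main.
have : ga * (eps / 2 * (1 - s) ^+ 2 * I4 + ((2^-1 * (1 + s) ^+ 2 - s) * (2 * m0)
    + 2^-1 * (1 + s) ^+ 2 * (k - m0) * (1 - -1))) <= 0.
  apply: mulr_ge0_le0; first by rewrite divr_ge0 ?sqr_ge0// ltW.
  rewrite (_ : _ + _ = eps / 2 * (1 - s) ^+ 2 * I4 + (1 + s) ^+ 2 * k - 2 * m0 * s).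
    by rewrite subr_le0.
  by field.
move=> /(le_trans main) ?; lra.
Qed.

Let sqr_shift (a b r M : R) : `|a - b| <= r -> r <= 1 -> `|b| <= M ->
  a * a <= b * b + r * (1 + 2 * M).
Proof.
move=> ab r1 bM; have n0 : 0 <= `|a - b| by [].
have h1 : (a - b) ^+ 2 <= r.
  rewrite -real_normK ?num_real// expr2.
  apply: le_trans (ler_pM n0 n0 ab (le_trans ab r1)) _.
  by rewrite mulr1.
have h2 : b * (a - b) <= M * r.
  apply: le_trans (ler_norm _) _; rewrite normrM.
  exact: ler_pM.
by move: h1 h2; rewrite expr2; lra.
Qed.

(** Convergence of the densities in [L^1] is uniform convergence of their
    primitives. *)
Lemma energy_limit e : 0 < e ->
  \forall t \near 0^'+, energy delta eta t < energy delta eta 0 + e.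
Proof.
move=> e0.
have cD0 : {within `[-1, 1], continuous (D ^~ 0)}.
  by apply: parameterized_integral_continuous => //; exact: sq_integrable_integrable.
have cH0 : {within `[-1, 1], continuous (H ^~ 0)}.
  by apply: parameterized_integral_continuous => //; exact: sq_integrable_integrable.
have [M1 M10 HM1] := within_bounded cD0; have [M2 M20 HM2] := within_bounded cH0.
pose K := (1 + 2 * M1) + (1 + 2 * M2).
have K0 : 0 < K by rewrite /K; lra.
pose r := Num.min 1 (e / (2 * K)).
have r0 : 0 < r by rewrite lt_min ltr01 divr_gt0// mulr_gt0.
have r1 : r <= 1 by rewrite ge_min lexx.
have rK : r * K < e.
  apply: (@le_lt_trans _ _ (e / (2 * K) * K)).
    by rewrite ler_wpM2r ?(ltW K0)// ge_min lexx orbT.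
  by rewrite (_ : e / (2 * K) * K = e / 2); [lra|field; rewrite gt_eqF].
have cd t : 0 < t -> {within `[-1, 1], continuous (delta ^~ t)} by exact: contQ_slice.
have ce t : 0 < t -> {within `[-1, 1], continuous (eta ^~ t)} by exact: contQ_slice.
have hd := L2_cvg_norm cd delta_init (np_delta_init np) r0.
have he := L2_cvg_norm ce eta_init (np_eta_init np) r0.
near=> t; have t0 : 0 < t by near: t; exact: nbhs_right_gt.
have kd : itg (-1) 1 (fun x => `|delta x t - delta x 0|) < r by near: t.
have ke : itg (-1) 1 (fun x => `|eta x t - eta x 0|) < r by near: t.
rewrite (energy_primitives (cD t0) (cH t0)) (energy_primitives cD0 cH0).
have c0 := within_add (within_mul cD0 cD0) (within_mul cH0 cH0).
have ct := within_add (within_mul (cD t0) (cD t0)) (within_mul (cH t0) (cH t0)).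
have : itg (-1) 1 (fun x => D x t * D x t + H x t * H x t) <=
    itg (-1) 1 (fun x => D x 0 * D x 0 + H x 0 * H x 0 + r * K).
  apply: (int_le ct (within_add c0 (within_cst _ (r * K)))).
  move=> x x1; have x1' : -1 <= x <= 1 by case/andP: x1 => /ltW -> /ltW ->.
  have hD : `|D x t - D x 0| <= r.
    apply: le_trans (ltW kd); apply: primitive_dist => //.
      exact: integrable_within (cd t t0).
    exact: sq_integrable_integrable.
  have hH : `|H x t - H x 0| <= r.
    apply: le_trans (ltW ke); apply: primitive_dist => //.
      exact: integrable_within (ce t t0).
    exact: sq_integrable_integrable.
  have := sqr_shift hD r1 (HM1 x x1'); have := sqr_shift hH r1 (HM2 x x1').
  rewrite /K; lra.
rewrite (int_add c0 (within_cst _ (r * K))) int_cst//; lra.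
Unshelve. all: by end_near. Qed.

End perturbation.

Lemma mean_sqr_le_energy (R : realType) (delta eta : R -> R -> R) (t : R) :
  mean_primitive delta t ^+ 2 <= energy delta eta t.
Proof.
rewrite /energy -addrA -subr_ge0.
set I := \int[_]_(_ in _) _; have I0 : 0 <= I.
  by apply: Rintegral_ge0 => x _; rewrite addr_ge0// sqr_ge0.
rewrite (_ : _ - _ = 2^-1 * I + mean_primitive eta t ^+ 2); last by ring.
by rewrite addr_ge0 ?sqr_ge0// mulr_ge0// invr_ge0.
Qed.

(** * Main result *)

(** The hypothesis on [gam] is what makes the boundary dissipation, of size
    [m0 * gam], pay for the two boundary layer terms. *)
Lemma layer_budget (R : realFieldType) (m0 eps gam gmax kap kap' Psi s : R) :
  0 < m0 -> 0 < gam -> gam <= gmax -> 0 <= kap' -> kap' <= kap ->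
  eps * Psi <= 3 * kap' ->
  ((1 + 2 * gmax) ^+ 2 + 3) * kap <= 4 * m0 * gam ->
  s = gam / (1 + gam) ->
  eps / 2 * (1 - s) ^+ 2 * Psi + (1 + s) ^+ 2 * (kap' / 2) <= 2 * m0 * s.
Proof.
move=> m00 g0 gg k'0 kk PsiK G sE.
have g1 : 0 < 1 + gam by rewrite addr_gt0.
have i0 : 0 < (1 + gam)^-1 by rewrite invr_gt0.
have i1 : (1 + gam)^-1 <= 1 by rewrite invf_le1// lerDl ltW.
have sq : (1 + 2 * gam) ^+ 2 <= (1 + 2 * gmax) ^+ 2.
  by rewrite lerXn2r ?nnegrE; lra.
have X : (1 + 2 * gam) ^+ 2 * kap' + 3 * kap' <= 4 * m0 * gam.
  apply: le_trans G; rewrite -mulrDl; apply: ler_pM => //.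
    by rewrite addr_ge0// sqr_ge0.
  by rewrite lerD2r.
set r := (1 + gam)^-1 in i0 i1.
have -> : eps / 2 * (1 - s) ^+ 2 * Psi + (1 + s) ^+ 2 * (kap' / 2)
    = r ^+ 2 * (2^-1 * (eps * Psi + (1 + 2 * gam) ^+ 2 * kap')).
  by rewrite sE /r; field; rewrite gt_eqF.
have -> : 2 * m0 * s = r * (2 * m0 * gam) by rewrite sE /r; field; rewrite gt_eqF.
have Y : 2^-1 * (eps * Psi + (1 + 2 * gam) ^+ 2 * kap') <= 2 * m0 * gam by lra.
have mg : 0 <= 2 * m0 * gam by rewrite !mulr_ge0// ltW.
apply: (@le_trans _ _ (r ^+ 2 * (2 * m0 * gam))).
  by rewrite ler_wpM2l ?sqr_ge0.
by rewrite ler_wpM2r// expr2 ler_piMl// ltW.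
Qed.

Theorem theorem1p3 (R : realType) (m0 phi1 : R) (hm0 : 0 < m0)
    (hphi1 : 0 < phi1) :
  exists2 eps' : R, 0 < eps' &
  forall (gmax eps gam : R),
    0 < gmax ->
    0 < eps < eps' ->
    0 < gam <= gmax ->
    gam / Num.sqrt eps >
      ((1 + 2 * gmax) ^+ 2 + 3) * K0const phi1 * phi1 / (4 * Mconst m0 phi1) ->
  forall (psi : R -> R) (delta eta phi : R -> R -> R),
    steady_state m0 phi1 eps gam psi ->
    NP_solution m0 eps gam psi delta eta phi ->
    \int[lebesgue_measure]_(x in `[-1, 1]) delta x 0 = 0 ->
    \int[lebesgue_measure]_(x in `[-1, 1]) eta x 0 = 0 ->
    let n_init := fun x => cations0 m0 psi x + 2^-1 * (delta x 0 + eta x 0) in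
    let p_init := fun x => anions0 m0 psi x + 2^-1 * (eta x 0 - delta x 0) in
    in_L2 n_init -> in_L2 p_init ->
    (forall x : R, -1 < x < 1 -> 0 <= n_init x /\ 0 <= p_init x) ->
    let Dbar := primitive_bar delta in
    let Hbar := primitive_bar eta in
    let d := mean_primitive delta in
    [/\ m0eps m0 phi1 eps > m0 / 2,
        forall t : R, 0 < t ->
          derivable (energy delta eta) t 1 /\
          derive1 (energy delta eta) t <=
            - (\int[lebesgue_measure]_(x in `[-1, 1])
                 (dx Dbar x t ^+ 2
                  + (2^-1 - d t ^+ 2 / (m0 * eps)) * dx Hbar x t ^+ 2))
            - (4 * eps)^-1 * m0eps m0 phi1 eps
              * (\int[lebesgue_measure]_(x in `[-1, 1]) (Dbar x t ^+ 2))
      & forall theta : R, 0 < theta < 1 ->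
          energy delta eta 0 < theta * m0 * eps / 2 ->
          forall t : R, 0 <= t ->
            2^-1 - d t ^+ 2 / (m0 * eps) > 2^-1 * (1 - theta) /\
            2^-1 * (1 - theta) > 0].
Proof.
have KP0 := K0const_gt0 hphi1; set KP := K0const phi1 * phi1 in KP0.
have M0 : 0 < Mconst m0 phi1 := Mconst_gt0 hm0.
set M := Mconst m0 phi1 in M0 *.
(* The first bound makes [2 * kap] less than [m0 / 2]; the second lets the part of
   the steady field energy that is linear in [eps] be absorbed by the layer. *)
exists (Num.min ((M / (4 * KP)) ^+ 2) (m0 / (4 * phi1 ^+ 2))).
  by rewrite lt_min exprn_gt0 ?divr_gt0// mulr_gt0// exprn_gt0.
move=> gmax eps gam gmax0 /andP[eps0]; rewrite lt_min => /andP[eps1 eps2].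
move=> /andP[gam0 gamle] hgam psi delta eta phi ss np mass_d mass_e n_init p_init
  L2n L2p init_ge0 Dbar Hbar d.
have se0 : 0 < Num.sqrt eps by rewrite sqrtr_gt0.
have small : 4 * eps * phi1 ^+ 2 <= m0.
  have p2 : 0 < 4 * phi1 ^+ 2 by rewrite mulr_gt0// exprn_gt0.
  by move: eps2; rewrite ltr_pdivlMr// => /ltW; rewrite mulrCA mulrA.
pose kap := m0 * KP * (Num.sqrt eps / M).
pose kap' := Num.sqrt (m0 * eps) * (expR phi1 - 1).
have kk : kap' <= kap := layer_constant hm0 hphi1 eps0.
have k'0 : 0 <= kap'.
  by rewrite mulr_ge0 ?sqrtr_ge0// subr_ge0 -expR0 ler_expR ltW.
have m0epsE : m0eps m0 phi1 eps = m0 - 2 * kap.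
  by rewrite /m0eps /kap /KP -/M; ring.
have sq4 : 4 * KP * (Num.sqrt eps / M) < 1.
  rewrite mulrA ltr_pdivrMr// mul1r.
  have K4 : 0 < 4 * KP by rewrite mulr_gt0.
  rewrite mulrC -ltr_pdivlMr//.
  have MK : 0 <= M / (4 * KP) by rewrite divr_ge0// ltW.
  by rewrite -[ltRHS]ger0_norm// -sqrtr_sqr ltr_sqrt// exprn_gt0// divr_gt0.
have m'half : m0 / 2 < m0eps m0 phi1 eps.
  rewrite m0epsE /kap.
  have : m0 * (4 * KP * (Num.sqrt eps / M)) < m0 * 1 by rewrite ltr_pM2l.
  lra.
have G : ((1 + 2 * gmax) ^+ 2 + 3) * kap <= 4 * m0 * gam.
  move: hgam; rewrite ltr_pdivlMr// => /ltW.
  rewrite -(ler_pM2l (_ : 0 < 4 * m0)) ?mulr_gt0//; apply: le_trans.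
  rewrite le_eqVlt; apply/orP; left; apply/eqP.
  by rewrite /kap /KP; field; rewrite gt_eqF.
have sn := in_L2_sq_integrable L2n; have sp := in_L2_sq_integrable L2p.
have delta_init : sq_integrable (delta ^~ 0).
  have := sq_integrableB (sq_integrableB sn sp) (sq_integrable_within (delta0_continuous ss)).
  congr sq_integrable; apply/funext => x.
  by rewrite /n_init /p_init /delta0; field.
have eta_init : sq_integrable (eta ^~ 0).
  have := sq_integrableB (sq_integrableD sn sp) (sq_integrable_within (eta0_continuous ss)).
  congr sq_integrable; apply/funext => x.
  by rewrite /n_init /p_init /eta0; field.
have n0 (x : R) : -1 < x < 1 -> 0 <= n_init x by move=> /init_ge0[].
have p0 (x : R) : -1 < x < 1 -> 0 <= p_init x by move=> /init_ge0[].
have Psi := field_energy hm0 hphi1 eps0 gam0 ss small.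
have budget := layer_budget hm0 gam0 gamle k'0 kk Psi G erefl.
have w0 x : 0 <= eta0 m0 psi x - m0 + kap' / 2.
  have := eta0_lower hm0 hphi1 eps0 gam0 ss x; rewrite -/kap'; lra.
have m'le : m0eps m0 phi1 eps <= m0 - 4 * (kap' / 2) by rewrite m0epsE; lra.
have dbar (u : R -> R -> R) (x t : R) : C2x u -> -1 < x < 1 -> 0 < t ->
    dx (primitive_bar u) x t = u x t.
  move=> cu x1 t0; apply: (dx_is_derive (u := primitive_bar u)) => //.
  rewrite -[u x t]subr0.
  exact: (is_derive_fctB (is_derive_primitive_slice cu x1 t0)
    (is_derive_fct_cst x (mean_primitive u t))).
have dissipation (t : R) : 0 < t ->
    derivable (energy delta eta) t 1 /\
    derive1 (energy delta eta) t <=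
      - itg (-1) 1 (fun x => dx Dbar x t ^+ 2
          + (2^-1 - d t ^+ 2 / (m0 * eps)) * dx Hbar x t ^+ 2)
      - (4 * eps)^-1 * m0eps m0 phi1 eps * itg (-1) 1 (fun x => Dbar x t ^+ 2).
  move=> t0; have [dE EE] := is_derive_energy eps0 ss np t0.
  split=> //; rewrite derive1E EE.
  set c := 2^-1 - _.
  have cde : {within `[-1, 1], continuous (delta ^~ t)}.
    by apply: contQ_slice t0; case: (np_delta_x np) => -[].
  have cet : {within `[-1, 1], continuous (eta ^~ t)}.
    by apply: contQ_slice t0; case: (np_eta_x np) => -[].
  rewrite (int_eq_oo (f := fun x => dx Dbar x t ^+ 2 + c * dx Hbar x t ^+ 2)
    (g := fun x => delta x t ^+ 2 + c * eta x t ^+ 2)); last 2 first.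
  - exact: within_add (within_exp 2 cde) (within_mul (within_cst _ c) (within_exp 2 cet)).
  - move=> x x1; have Ed : dx Dbar x t = delta x t := dbar _ _ _ (np_delta_x np) x1 t0.
    have Ee : dx Hbar x t = eta x t := dbar _ _ _ (np_eta_x np) x1 t0.
    by rewrite Ed Ee.
  have k0 : 0 <= kap' / 2 by rewrite divr_ge0.
  exact (energy_dissipation hm0 eps0 gam0 ss np delta_init eta_init mass_d mass_e
    n0 p0 t0 k0 m'le w0 budget).
split=> // theta /andP[th0 th1] Einit t t0.
have me0 : 0 < m0 * eps by rewrite mulr_gt0.
have coef (s : R) : energy delta eta s < theta * m0 * eps / 2 ->
    2^-1 * (1 - theta) < 2^-1 - d s ^+ 2 / (m0 * eps).
  move=> Es; have := le_lt_trans (mean_sqr_le_energy delta eta s) Es.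
  rewrite -/d => ds.
  have : d s ^+ 2 / (m0 * eps) < theta / 2 by rewrite ltr_pdivrMr//; lra.
  lra.
split; last by rewrite mulr_gt0 ?invr_gt0// subr_gt0.
apply: (coef t); move: t0; rewrite le_eqVlt => /predU1P[<- //|t0].
apply: (stays_below _ _ _ Einit t0) => [s s0|s s0 Es|e e0].
- by have [] := dissipation s s0.
- have [_ /le_trans] := dissipation s s0; apply.
  rewrite -opprD oppr_le0 addr_ge0//.
    apply: int_ge0 => x _; rewrite addr_ge0 ?sqr_ge0// mulr_ge0 ?sqr_ge0//.
    by apply: ltW; apply: lt_trans (coef s Es); rewrite mulr_gt0 ?invr_gt0// subr_gt0.
  rewrite mulr_ge0//; last by apply: int_ge0 => x _; exact: sqr_ge0.
  rewrite mulr_ge0//; first by rewrite invr_ge0 mulr_ge0// ltW.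
  by apply: ltW; apply: lt_trans m'half; rewrite divr_gt0.
- exact: (energy_limit np delta_init eta_init e0).
Qed.
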